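(* For all $w\in\mathbb{C}$ and $\theta\in\mathbb{R}$, Dawson's integral $F$ satisfies $$F(w\cos\theta) = w\,e^{-w^2/2}\sum_{m=0}^\infty(-\mathrm{i})^m\,j_m(-\mathrm{i} w^2/2)\,\cos\big((2m+1)\theta\big).$$
   Context: Dawson's integral: $F(x)=e^{-x^2}\int_0^x e^{t^2}\,\mathrm{d}t$. $j_m$ ($m\ge0$) is the spherical Bessel function of the first kind, $j_m(x)=\sqrt{\pi/(2x)}\,J_{m+\frac12}(x)$, which extends to an entire function of $x$. *)

(* Defs.v *)
From Stdlib Require Import Reals Factorial.
From Coquelicot Require Import Coquelicot.
Open Scope R_scope.

Definition Cexp (z : C) : C :=
  (exp (Re z) * cos (Im z), exp (Re z) * sin (Im z)).

(* Principal argument, with values in (-PI, PI]; meaningful for z <> 0. *)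
Definition Carg (z : C) : R :=
  if Rle_dec 0 (Im z) then acos (Re z / Cmod z) else - acos (Re z / Cmod z).

(* Principal logarithm and principal powers z^a (a real); meaningful for
   z <> 0. *)
Definition Clog (z : C) : C := (ln (Cmod z), Carg z).
Definition Cpower (z : C) (a : R) : C := Cexp (RtoC a * Clog z)%C.
Definition Csqrt (z : C) : C := Cpower z (1 / 2).

(* Sum of a complex series; meaningful when the series converges. *)
Definition CSeries (a : nat -> C) : C :=
  (Series (fun k => Re (a k)), Series (fun k => Im (a k))).

(* Integral of f along the straight segment from a to b. *)
Definition CInt_segment (f : C -> C) (a b : C) : C :=
  RInt (V := C_R_CompleteNormedModule)
    (fun t : R => (f (a + RtoC t * (b - a)) * (b - a))%C) 0 1.

(* The integrand is entire, so the integral from 0 to z does not depend on the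
   path; the segment is used. *)
Definition Dawson (z : C) : C :=
  (Cexp (- (z ^ 2)) * CInt_segment (fun t => Cexp (t ^ 2)) 0 z)%C.

(* Euler's integral, for x > 0. *)
Definition Gamma (x : R) : R :=
  RInt_gen (fun t => Rpower t (x - 1) * exp (- t))
    (at_right 0) (Rbar_locally p_infty).

(* J_nu(z) = (z/2)^nu sum_k (-1)^k / (k! Gamma(nu+k+1)) (z/2)^(2k), principal
   branch; here nu > -1 and z <> 0. *)
Definition BesselJ (nu : R) (z : C) : C :=
  (Cpower (z / 2) nu *
   CSeries (fun k => RtoC ((-1) ^ k / (INR (fact k) * Gamma (nu + INR k + 1)))
                     * (z / 2) ^ (2 * k)))%C.

(* The complement of the cut (-oo, 0]. *)
Definition slit_plane (z : C) : Prop := Im z <> 0 \/ 0 < Re z.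

Lemma slit_plane_dec (z : C) : {slit_plane z} + {~ slit_plane z}.
Proof.
  unfold slit_plane.
  destruct (Req_EM_T (Im z) 0) as [H|H].
  - destruct (Rlt_dec 0 (Re z)) as [H'|H'].
    + left; now right.
    + right; intros [?|?]; contradiction.
  - left; now left.
Defined.

Definition sph_bessel_principal (m : nat) (z : C) : C :=
  (Csqrt (RtoC PI / (2 * z)) * BesselJ (INR m + 1 / 2) z)%C.

(* With principal branches the formula above is holomorphic off the cut only:
   it has the wrong sign on (-oo, 0) and is undefined at 0.  The entire function
   extending it takes on the cut the value obtained by continuity from the slit
   plane, which is dense; [iota] picks this (unique) limit. *)
Definition sph_bessel_j (m : nat) (z : C) : C :=
  if slit_plane_dec z then sph_bessel_principal m z
  else iota
         (fun l : C_R_CompleteNormedModule => filterlim (sph_bessel_principal m)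
                     (within slit_plane (locally z)) (locally l)).

(* Main.v *)
Require Import Defs.
From Stdlib Require Import Reals Lra Lia Factorial.
From Coquelicot Require Import Coquelicot.
Open Scope R_scope.

(** Put x = w^2/2.  Since j_m (-i x) = (-i)^m i_m x with i_m the modified
    spherical Bessel function, the series is
    S x = sum_m (-1)^m i_m x cos ((2m+1) theta).  Absorbing the exponentials into
    the integral gives F (w cos theta) = w exp (-x) D x with
    D x = cos theta * int_0^1 exp (x q s) ds and
    q s = s^2 (1 + cos (2 theta)) - cos (2 theta).  Both D and S solve
    2 x y' + (1 + 2 x cos (2 theta)) y = cos theta * exp x: for D integrate
    the derivative of s * q s ^ (n+1) over [0, 1], and for S use
    2 x i_m' + i_m = x (i_(m-1) + i_(m+1)) together with
    2 cos (2 theta) cos ((2m+1) theta) = cos ((2m+3) theta) + cos ((2m-1) theta).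
    On power series coefficients this equation is a first order recurrence with
    a unique solution.  Only the terms m <= n of S contribute to x^n, and the
    coefficients of x^n in the i_m are nonnegative with sum at most 1/n!, so the
    M-th partial sum of S differs from D by a tail of an exponential series. *)

(** * Complex series *)

Lemma sum_n_C_components (a : nat -> C) (n : nat) :
  sum_n a n = (sum_n (fun k => Re (a k)) n, sum_n (fun k => Im (a k)) n).
Proof.
  induction n as [|n IH].
  - rewrite !sum_O. now destruct (a O).
  - rewrite !sum_Sn, IH. reflexivity.
Qed.

(** Balls in [C] are products of balls in the two coordinates, so convergence in [C] gives
    convergence of both component series that [CSeries] sums. *)
Lemma CSeries_unique (a : nat -> C) (l : C) : is_series a l -> CSeries a = l.
Proof.
  intros H.
  assert (Hb : forall eps : posreal, eventually (fun n => ball l eps (sum_n a n))).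
  { intros eps. apply (H (fun y => ball l eps y)). now exists eps. }
  rewrite (surjective_pairing l). unfold CSeries. f_equal;
    apply is_series_unique; apply (proj2 (filterlim_locally _ _)); intros eps;
    destruct (Hb eps) as [N HN]; exists N; intros n Hn;
    specialize (HN n Hn); rewrite sum_n_C_components in HN; apply HN.
Qed.

Lemma is_series_C_squeeze (a : nat -> C) (l : C) (u : nat -> R) :
  (forall n, Cmod (sum_n a n - l) <= u n) -> is_lim_seq u 0 -> is_series a l.
Proof.
  intros Hu Hl. apply (proj2 (filterlim_locally _ _)). intros eps.
  apply is_lim_seq_spec in Hl. destruct (Hl eps) as [N HN].
  exists N. intros n Hn. apply C_NormedModule_mixin_compat1.
  specialize (HN n Hn). rewrite Rminus_0_r in HN.
  apply Rle_lt_trans with (u n); [apply Hu|].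
  now apply Rle_lt_trans with (2 := HN), Rle_abs.
Qed.

Lemma is_series_C_bound (a : nat -> C) (l : C) (g : nat -> R) (L : R) :
  is_series a l -> (forall n, Cmod (a n) <= g n) -> is_series g L -> Cmod l <= L.
Proof.
  intros Ha Hg HL.
  assert (Hs : forall n, Cmod (sum_n a n) <= sum_n g n).
  { induction n as [|n IH].
    - rewrite !sum_O. apply Hg.
    - rewrite !sum_Sn. eapply Rle_trans; [apply Cmod_triangle|].
      apply Rplus_le_compat; [apply IH | apply Hg]. }
  change (Rbar_le (Finite (Cmod l)) (Finite L)).
  apply (is_lim_seq_le (fun n => Cmod (sum_n a n)) (sum_n g)).
  - exact Hs.
  - eapply filterlim_comp; [exact Ha|].
    apply (filterlim_norm (K := C_AbsRing) (V := C_NormedModule)).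
  - exact HL.
Qed.

Lemma ex_series_C_bound (a : nat -> C) (g : nat -> R) :
  (forall n, Cmod (a n) <= g n) -> ex_series g -> ex_series a.
Proof.
  intros H Hg. apply (ex_series_le (V := C_CompleteNormedModule) a g); [|exact Hg].
  exact H.
Qed.

Lemma is_series_C_mult (c l : C) (a : nat -> C) :
  is_series a l -> is_series (fun n => c * a n)%C (c * l)%C.
Proof. exact (is_series_scal_l (K := C_AbsRing) (V := C_NormedModule) c a l). Qed.

Lemma is_series_C_plus (a b : nat -> C) (la lb : C) :
  is_series a la -> is_series b lb -> is_series (fun n => a n + b n)%C (la + lb)%C.
Proof. exact (is_series_plus (K := C_AbsRing) (V := C_NormedModule) a b la lb). Qed.

Lemma is_series_exp (r : R) : is_series (fun n => r ^ n / INR (fact n)) (exp r).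
Proof.
  apply is_series_ext with (2 := is_exp_Reals r).
  intros n. unfold scal; simpl. unfold mult; simpl.
  rewrite pow_n_pow. reflexivity.
Qed.

Lemma is_lim_seq_pow_fact (r : R) :
  is_lim_seq (fun n => r ^ S n / INR (fact (S n))) 0.
Proof.
  apply (is_lim_seq_incr_1 (fun n => r ^ n / INR (fact n))).
  apply (ex_series_lim_0 (fun n => r ^ n / INR (fact n))).
  eexists; apply is_series_exp.
Qed.

(** Passes from a series z^m f(z^2), indexed by the powers of z^2, to the same series indexed by the
    powers of z. The partial sums of [c] vanish below m and repeat each partial sum of [b] twice, at
    m + 2k and m + 2k + 1. *)
Lemma is_series_sparse (m : nat) (b c : nat -> C) (l : C) :
  (forall n, (n < m)%nat -> c n = 0) ->
  (forall k, c (m + 2 * k)%nat = b k) ->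
  (forall k, c (m + 2 * k + 1)%nat = 0) ->
  is_series b l -> is_series c l.
Proof.
  intros H0 He Ho Hb.
  assert (Hlow : forall n, (n < m)%nat -> sum_n c n = RtoC 0).
  { induction n as [|n IH]; intros Hn.
    - rewrite sum_O. now apply H0.
    - rewrite sum_Sn, IH, H0 by lia. apply (plus_zero_l (G := C_AbelianMonoid)). }
  assert (Hs : forall k, sum_n c (m + 2 * k) = sum_n b k
                         /\ sum_n c (m + 2 * k + 1) = sum_n b k).
  { assert (Hodd : forall k, sum_n c (m + 2 * k) = sum_n b k ->
                             sum_n c (m + 2 * k + 1) = sum_n b k).
    { intros k Hk. replace (m + 2 * k + 1)%nat with (S (m + 2 * k)) by lia.
      rewrite sum_Sn, Hk. replace (S (m + 2 * k)) with (m + 2 * k + 1)%nat by lia.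
      rewrite Ho. apply (plus_zero_r (G := C_AbelianMonoid)). }
    induction k as [|k [IH1 IH2]].
    - assert (E : sum_n c (m + 2 * 0) = sum_n b 0).
      { rewrite (sum_O b), <- (He O). replace (m + 2 * 0)%nat with m by lia.
        destruct m as [|m]; [apply sum_O|].
        rewrite sum_Sn, Hlow by lia. apply (plus_zero_l (G := C_AbelianMonoid)). }
      split; [exact E | now apply Hodd].
    - assert (E : sum_n c (m + 2 * S k) = sum_n b (S k)).
      { replace (m + 2 * S k)%nat with (S (m + 2 * k + 1)) by lia.
        rewrite !sum_Sn, IH2. f_equal. rewrite <- He. f_equal. lia. }
      split; [exact E | now apply Hodd]. }
  intros P HP. destruct (Hb P HP) as [N HN]. exists (m + 2 * N)%nat. intros n Hn.
  (* Rounding down absorbs the repetition, and n >= m + 2N makes the index on the right at least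
     N. *)
  assert (Hn' : sum_n c n = sum_n b ((n - m) / 2)).
  { pose proof (Nat.div_mod_eq (n - m) 2) as E.
    pose proof (Nat.mod_upper_bound (n - m) 2 ltac:(lia)) as F.
    destruct (Hs ((n - m) / 2)%nat) as [H1 H2].
    destruct ((n - m) mod 2)%nat as [|[|]] eqn:G; [| |lia].
    - rewrite <- H1. f_equal. lia.
    - rewrite <- H2. f_equal. lia. }
  refine (eq_ind_r P _ Hn'). apply HN. apply Nat.div_le_lower_bound; lia.
Qed.

(** * The complex exponential *)

Lemma Cexp_add (a b : C) : Cexp (a + b) = (Cexp a * Cexp b)%C.
Proof.
  destruct a as [a1 a2], b as [b1 b2]. unfold Cexp, Cmult; simpl.
  rewrite exp_plus, cos_plus, sin_plus. f_equal; ring.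
Qed.

Lemma Cexp_0 : Cexp 0 = 1.
Proof.
  unfold Cexp; simpl. rewrite exp_0, cos_0, sin_0. unfold RtoC. f_equal; ring.
Qed.

Lemma Cexp_RtoC (x : R) : Cexp x = exp x.
Proof.
  unfold Cexp, RtoC; simpl. rewrite cos_0, sin_0. f_equal; ring.
Qed.

Lemma Cexp_mult_INR (n : nat) (z : C) : Cexp (INR n * z) = (Cexp z ^ n)%C.
Proof.
  induction n as [|n IH].
  - simpl. replace (RtoC 0 * z)%C with (RtoC 0) by ring. apply Cexp_0.
  - rewrite S_INR, RtoC_plus, Cmult_plus_distr_r, Cexp_add, IH, Cmult_1_l.
    simpl. ring.
Qed.

Lemma Cmod_Cexp (z : C) : Cmod (Cexp z) = exp (Re z).
Proof.
  unfold Cmod, Cexp; simpl.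
  replace (_ + _) with (Rsqr (exp (Re z)) * (Rsqr (sin (Im z)) + Rsqr (cos (Im z))))
    by (unfold Rsqr; ring).
  rewrite sin2_cos2, Rmult_1_r. apply sqrt_Rsqr. apply Rlt_le, exp_pos.
Qed.

Lemma Cmod_Cexp_le (z : C) : Cmod (Cexp z) <= exp (Cmod z).
Proof.
  rewrite Cmod_Cexp. apply Rle_trans with (exp (Rabs (Re z))).
  - destruct (Rle_abs (Re z)) as [H|H]; [left; now apply exp_increasing|].
    rewrite <- H; apply Rle_refl.
  - destruct (re_le_Cmod z) as [H|H]; [left; now apply exp_increasing|].
    rewrite <- H; apply Rle_refl.
Qed.

Lemma is_derive_Re_Cexp_line (v z : C) (t : R) :
  is_derive (fun s : R => Re (v * Cexp (s * z))) t (Re (v * z * Cexp (t * z))).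
Proof.
  destruct v as [v1 v2], z as [z1 z2]. unfold Cexp, Cmult, RtoC; simpl.
  auto_derive; [exact I|]. unfold Rminus. ring.
Qed.

Lemma is_derive_n_Re_Cexp_line (v z : C) (k : nat) (t : R) :
  is_derive_n (fun s : R => Re (v * Cexp (s * z))) k t (Re (v * z ^ k * Cexp (t * z))).
Proof.
  revert t. induction k as [|k IH]; intros t.
  - change (Re (v * Cexp (t * z)) = Re (v * 1 * Cexp (t * z))). f_equal. ring.
  - unfold is_derive_n. apply is_derive_ext with (fun s : R => Re (v * z ^ k * Cexp (s * z))).
    + intros s. symmetry. apply is_derive_n_unique, IH.
    + rewrite Cpow_S. replace (v * (z * z ^ k))%C with (v * z ^ k * z)%C by ring.
      apply is_derive_Re_Cexp_line.
Qed.

Lemma Re_sum_n_mult (v : C) (a : nat -> C) (n : nat) :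
  Re (v * sum_n a n) = sum_f_R0 (fun k => Re (v * a k)%C) n.
Proof.
  induction n as [|n IH]; [now rewrite sum_O|].
  rewrite sum_Sn, tech5, <- IH.
  change (plus (sum_n a n) (a (S n))) with (sum_n a n + a (S n))%C.
  rewrite Cmult_plus_distr_l. reflexivity.
Qed.

(** The Lagrange form of the remainder is a statement about real functions, so it is applied on
    [0, 1] to s |-> Re (v exp (s z)), whose derivatives stay of the same shape. The free factor v
    selects a direction: v = 1 gives the real part of the error and v = -i the imaginary part. *)
Lemma Re_Cexp_Taylor (v z : C) (n : nat) :
  Rabs (Re (v * (Cexp z - sum_n (fun k => z ^ k / INR (fact k))%C n)))
  <= Cmod v * (exp (Cmod z) * (Cmod z ^ S n / INR (fact (S n)))).
Proof.
  set (f := fun s : R => Re (v * Cexp (s * z))).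
  destruct (Taylor_Lagrange f n 0 1) as [zeta [Hz E]].
  - lra.
  - intros t Ht k Hk. destruct k as [|k]; [exact I|].
    eexists. apply (is_derive_n_Re_Cexp_line v z (S k) t).
  - assert (D : forall k t, Derive_n f k t = Re (v * z ^ k * Cexp (t * z))).
    { intros k t. apply is_derive_n_unique, is_derive_n_Re_Cexp_line. }
    unfold f at 1 in E. rewrite Cmult_1_l in E.
    set (T := sum_n _ n).
    replace (v * (Cexp z - T))%C with (v * Cexp z - v * T)%C by ring.
    change (Re (v * Cexp z - v * T)) with (Re (v * Cexp z) - Re (v * T)). unfold T.
    rewrite E, Re_sum_n_mult, D.
    rewrite (sum_eq _ (fun k => Re (v * (z ^ k / INR (fact k)))) n).
    2:{ intros k _. rewrite D.
        replace (0 * z)%C with (RtoC 0) by ring. rewrite Cexp_0.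
        replace (v * z ^ k * 1)%C with (v * z ^ k)%C by ring.
        unfold Cdiv. rewrite <- RtoC_inv, Cmult_assoc.
        destruct (v * z ^ k)%C as [p q]. unfold Cmult, RtoC; simpl.
        rewrite Rminus_0_r, pow1. field. all: apply INR_fact_neq_0. }
    match goal with |- Rabs (?s + ?r - ?s) <= _ => replace (s + r - s) with r by ring end.
    rewrite Rminus_0_r, pow1, Rabs_mult.
    assert (F : 0 < / INR (fact (S n))) by apply Rinv_0_lt_compat, INR_fact_lt_0.
    unfold Rdiv. rewrite Rmult_1_l, (Rabs_pos_eq (/ _)) by lra.
    apply Rle_trans with (/ INR (fact (S n)) * (Cmod v * Cmod z ^ S n * exp (Cmod z))).
    2:{ right. ring. }
    apply Rmult_le_compat_l; [lra|].
    eapply Rle_trans; [apply re_le_Cmod|].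
    rewrite !Cmod_mult, Cmod_pow. apply Rmult_le_compat_l.
    + apply Rmult_le_pos; [apply Cmod_ge_0 | apply pow_le, Cmod_ge_0].
    + eapply Rle_trans; [apply Cmod_Cexp_le|].
      rewrite Cmod_mult, Cmod_R, Rabs_pos_eq by lra.
      destruct (Rle_lt_or_eq_dec (zeta * Cmod z) (Cmod z)) as [H|H].
      * rewrite <- (Rmult_1_l (Cmod z)) at 2.
        apply Rmult_le_compat_r; [apply Cmod_ge_0 | lra].
      * left; now apply exp_increasing.
      * rewrite H; apply Rle_refl.
Qed.

Lemma Cmod_le_Re_Im (z : C) : Cmod z <= Rabs (Re z) + Rabs (Im z).
Proof.
  replace z with (RtoC (Re z) + Ci * RtoC (Im z))%C at 1
    by (destruct z; unfold Cplus, Cmult, RtoC, Ci; simpl; f_equal; ring).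
  eapply Rle_trans; [apply Cmod_triangle|].
  rewrite Cmod_mult, Cmod_Ci, !Cmod_R. lra.
Qed.

Lemma Cexp_Taylor (z : C) (n : nat) :
  Cmod (Cexp z - sum_n (fun k => z ^ k / INR (fact k))%C n)
  <= 2 * (exp (Cmod z) * (Cmod z ^ S n / INR (fact (S n)))).
Proof.
  set (d := (Cexp z - _)%C).
  eapply Rle_trans; [apply Cmod_le_Re_Im|].
  pose proof (Re_Cexp_Taylor 1 z n) as H1.
  pose proof (Re_Cexp_Taylor (- Ci) z n) as H2. fold d in H1, H2.
  rewrite Cmod_1, Cmult_1_l in H1. rewrite Cmod_opp, Cmod_Ci in H2.
  replace (Re (- Ci * d)) with (Im d) in H2
    by (destruct d; unfold Cmult, Copp, Ci; simpl; ring).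
  lra.
Qed.

(** * Power series coefficients *)

(* [(2 n + 1)!!] *)
Fixpoint odd_dfact (n : nat) : R :=
  match n with
  | O => 1
  | S k => (2 * INR k + 3) * odd_dfact k
  end.

Lemma odd_dfact_pos (n : nat) : 0 < odd_dfact n.
Proof.
  induction n as [|n IH]; simpl; [lra|].
  apply Rmult_lt_0_compat; [|exact IH]. pose proof (pos_INR n). lra.
Qed.

(** This is (2k+1)! = (2k)!! (2k+1)!!, with (2k)!! = 2^k k!. *)
Lemma odd_dfact_fact (k : nat) :
  INR (fact (2 * k + 1)) = 2 ^ k * INR (fact k) * odd_dfact k.
Proof.
  induction k as [|k IH]; [simpl; ring|].
  replace (2 * S k + 1)%nat with (S (S (2 * k + 1))) by lia.
  rewrite !fact_simpl, !mult_INR, IH, !S_INR, plus_INR, mult_INR.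
  simpl. ring.
Qed.

Lemma odd_dfact_ge_1 (n : nat) : 1 <= odd_dfact n.
Proof.
  induction n as [|n IH]; simpl; [lra|].
  pose proof (pos_INR n). nra.
Qed.

(** The coefficient of z^(m+2k) in i_m, and in j_m up to the sign (-1)^k. *)
Definition bessel_coef (m k : nat) : R :=
  / (2 ^ k * INR (fact k) * odd_dfact (m + k)).

Lemma bessel_coef_pos (m k : nat) : 0 < bessel_coef m k.
Proof.
  apply Rinv_0_lt_compat.
  repeat apply Rmult_lt_0_compat;
    [apply pow_lt; lra | apply INR_fact_lt_0 | apply odd_dfact_pos].
Qed.

Lemma bessel_coef_le (m k : nat) : bessel_coef m k <= / INR (fact k).
Proof.
  apply Rinv_le_contravar; [apply INR_fact_lt_0|].
  pose proof (INR_fact_lt_0 k). pose proof (odd_dfact_ge_1 (m + k)).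
  assert (1 <= 2 ^ k) by (apply pow_R1_Rle; lra).
  assert (INR (fact k) <= 2 ^ k * INR (fact k)) by nra. nra.
Qed.

(* Coefficient of [x^n] in [i_m x = i^(-m) j_m (i x)], read off
   [2 x i_m' + i_m = x (i_(m-1) + i_(m+1))] for [m > 0] and
   [2 x i_0' + i_0 = x (i_1 - i_0) + exp x]. *)
Fixpoint i_coef (n m : nat) : R :=
  match n with
  | O => match m with O => 1 | S _ => 0 end
  | S n' =>
      match m with
      | O => (i_coef n' 1 + / INR (fact (S n')) - i_coef n' 0) / (2 * INR n' + 3)
      | S m' => (i_coef n' m' + i_coef n' (S (S m'))) / (2 * INR n' + 3)
      end
  end.

(** The general recurrence would involve i_(-1) x = cosh x / x here. Since x i_0 x = sinh x, one has
    x i_(-1) x = exp x - x i_0 x, which is where 1 / (n+1)! and the negative term come from. *)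
Lemma i_coef_rec_0 (n : nat) :
  (2 * INR n + 3) * i_coef (S n) 0 = i_coef n 1 + / INR (fact (S n)) - i_coef n 0.
Proof. cbn [i_coef]. field.
  split; [apply INR_fact_neq_0 | pose proof (pos_INR n); lra]. Qed.

Lemma i_coef_rec_S (n m : nat) :
  (2 * INR n + 3) * i_coef (S n) (S m) = i_coef n m + i_coef n (S (S m)).
Proof. cbn [i_coef]. field. pose proof (pos_INR n); lra. Qed.

(** The recurrences move m by one step, hence swap the two parities of n - m (apart from the term at
    m = 0), so all three cases go through one induction on n, for every m at once. *)
Lemma i_coef_closed (n m : nat) :
  ((n < m)%nat -> i_coef n m = 0) /\
  (forall k, n = (m + 2 * k)%nat -> i_coef n m = bessel_coef m k) /\
  (forall k, n = (m + 2 * k + 1)%nat -> i_coef n m = 0).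
Proof.
  revert m. induction n as [|n IH]; intros m.
  - split; [|split]; [intros H|intros k H|intros k H].
    + destruct m; [lia|reflexivity].
    + assert (k = O) by lia. assert (m = O) by lia. subst.
      unfold bessel_coef. simpl. field.
    + lia.
  - assert (P : 2 * INR n + 3 <> 0) by (pose proof (pos_INR n); lra).
    destruct m as [|m].
    + pose proof (i_coef_rec_0 n) as E.
      destruct (IH 1%nat) as [L1 [C1 O1]]. destruct (IH O) as [L0 [C0 O0]].
      split; [lia|split]; intros k H; apply (Rmult_eq_reg_l (2 * INR n + 3)); trivial;
        rewrite E; clear E.
      * destruct k as [|k]; [lia|].
        rewrite (C1 k), (O0 k) by lia. unfold bessel_coef.
        replace (0 + S k)%nat with (S k) by lia. replace (1 + k)%nat with (S k) by lia.
        replace (S n) with (2 * S k)%nat by lia.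
        (* Writing 1 / (2k+2)! as (2k+3) / (2k+3)! makes the double factorial identity applicable,
           and the claim becomes a rational identity. *)
        pose proof (odd_dfact_fact (S k)) as F.
        replace (2 * S k + 1)%nat with (S (2 * S k)) in F by lia.
        rewrite fact_simpl, mult_INR in F.
        replace n with (2 * k + 1)%nat by lia.
        assert (Q : INR (S (2 * S k)) <> 0) by (apply not_0_INR; lia).
        apply (f_equal Rinv) in F.
        replace (/ INR (fact (2 * S k))) with
          (INR (S (2 * S k)) * / (INR (S (2 * S k)) * INR (fact (2 * S k))))
          by (field; split; [apply INR_fact_neq_0 | exact Q]).
        rewrite F, fact_simpl, mult_INR, !S_INR, plus_INR, !mult_INR, !S_INR.
        pose proof (odd_dfact_pos (S k)). pose proof (INR_fact_lt_0 k).
        assert (0 < 2 ^ k) by (apply pow_lt; lra). pose proof (pos_INR k).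
        simpl. simpl in H0. field. repeat split; try lra.
        assert (0 < odd_dfact k) by apply odd_dfact_pos. lra.
      (* With n = 2k, the term 1 / (2k+1)! cancels exactly against [bessel_coef 0 k]. *)
      * assert (n = 0 + 2 * k)%nat by lia. rewrite Rmult_0_r, (C0 k) by lia.
        replace (i_coef n 1) with 0.
        2:{ symmetry. destruct k as [|k]; [apply L1; lia | apply (O1 k); lia]. }
        unfold bessel_coef. replace (S n) with (2 * k + 1)%nat by lia.
        rewrite odd_dfact_fact. rewrite Nat.add_0_l. ring.
    + pose proof (i_coef_rec_S n m) as E.
      destruct (IH m) as [L0 [C0 O0]]. destruct (IH (S (S m))) as [L2 [C2 O2]].
      split; [|split]; [intros H|intros k H|intros k H];
        apply (Rmult_eq_reg_l (2 * INR n + 3)); trivial; rewrite E; clear E.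
      * rewrite L0, L2 by lia. ring.
      * rewrite (C0 k) by lia. unfold bessel_coef at 1.
        destruct k as [|k].
        -- rewrite L2 by lia. unfold bessel_coef. replace n with (m + 2 * 0)%nat by lia.
           replace (S m + 0)%nat with (S m) by lia. replace (m + 0)%nat with m by lia.
           rewrite plus_INR. simpl.
           pose proof (odd_dfact_pos m). pose proof (pos_INR m). field. split; lra.
        -- rewrite (C2 k) by lia. unfold bessel_coef.
           replace n with (m + 2 * S k)%nat by lia.
           replace (S (S m) + k)%nat with (S (m + S k)) by lia.
           replace (S m + S k)%nat with (S (m + S k)) by lia.
           rewrite fact_simpl, mult_INR, plus_INR, mult_INR, S_INR. simpl odd_dfact.
           rewrite plus_INR, S_INR.
           pose proof (odd_dfact_pos (m + S k)). pose proof (INR_fact_lt_0 k).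
           assert (0 < 2 ^ k) by (apply pow_lt; lra). pose proof (pos_INR k).
           pose proof (pos_INR m). simpl. field. repeat split; lra.
      * rewrite (O0 k) by lia.
        destruct k as [|k]; [rewrite L2 by lia | rewrite (O2 k) by lia]; ring.
Qed.

Lemma i_coef_ge_0 (n m : nat) : 0 <= i_coef n m.
Proof.
  destruct (i_coef_closed n m) as [L [Ev Od]].
  destruct (Nat.lt_ge_cases n m) as [H|H]; [rewrite L by easy; lra|].
  pose proof (Nat.div_mod_eq (n - m) 2) as E.
  pose proof (Nat.mod_upper_bound (n - m) 2 ltac:(lia)) as F.
  destruct ((n - m) mod 2)%nat as [|[|]]; [| |lia].
  - rewrite (Ev ((n - m) / 2)%nat) by lia. left; apply bessel_coef_pos.
  - rewrite (Od ((n - m) / 2)%nat) by lia. lra.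
Qed.

(** Summing the recurrence over m <= M: the shift to m + 1 gives the sum up to M + 1 without its
    first term, the shift to m - 1 the sum up to M without its last term, and m = 0 contributes one
    more -i_0. *)
Lemma sum_i_coef_rec (n M : nat) :
  (2 * INR n + 3) * sum_f_R0 (i_coef (S n)) M =
  / INR (fact (S n)) + sum_f_R0 (i_coef n) (S M) + sum_f_R0 (i_coef n) M
  - i_coef n M - 2 * i_coef n 0.
Proof.
  induction M as [|M IH].
  - rewrite tech5. simpl sum_f_R0. rewrite i_coef_rec_0. ring.
  - rewrite (tech5 (i_coef (S n))), Rmult_plus_distr_l, IH, i_coef_rec_S.
    rewrite !tech5. ring.
Qed.

(** After dropping the subtracted nonnegative terms, the induction closes because 1 / (n+1)! + 2 /
    n! = (2n+3) / (n+1)!. The upper limit M stays general since the recurrence also uses M + 1. *)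
Lemma sum_i_coef_le (n M : nat) : sum_f_R0 (i_coef n) M <= / INR (fact n).
Proof.
  revert M. induction n as [|n IH]; intros M.
  - right. induction M as [|M IHM]; [simpl; field|]. rewrite tech5, IHM. simpl. ring.
  - pose proof (pos_INR n) as P.
    apply (Rmult_le_reg_l (2 * INR n + 3)); [lra|]. rewrite sum_i_coef_rec.
    assert (F : / INR (fact n) = (INR n + 1) * / INR (fact (S n))).
    { rewrite fact_simpl, mult_INR, S_INR. field.
      split; [apply INR_fact_neq_0 | lra]. }
    pose proof (IH M). pose proof (IH (S M)).
    pose proof (i_coef_ge_0 n M). pose proof (i_coef_ge_0 n 0). nra.
Qed.

(** * Angular factors and the coefficient recurrence of the harmonic sums *)

Section Harmonics.

Variable theta : R.

Definition harmonic (m : nat) : R := (-1) ^ m * cos ((2 * INR m + 1) * theta).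

Lemma harmonic_0 : harmonic 0 = cos theta.
Proof.
  unfold harmonic. simpl. rewrite Rmult_1_l. f_equal. ring.
Qed.

(** This is the general recurrence continued to index -1, where (-1)^(-1) cos (-theta) is the
    negative of [harmonic 0]. *)
Lemma harmonic_rec_0 :
  2 * cos (2 * theta) * harmonic 0 = harmonic 0 - harmonic 1.
Proof.
  unfold harmonic. simpl INR.
  replace ((2 * 0 + 1) * theta) with theta by ring.
  replace ((2 * 1 + 1) * theta) with (2 * theta + theta) by ring.
  assert (E : cos theta = cos (2 * theta - theta)) by (f_equal; ring).
  rewrite cos_minus in E. rewrite cos_plus. simpl. lra.
Qed.

Lemma harmonic_rec_S (m : nat) :
  2 * cos (2 * theta) * harmonic (S m) = - harmonic (S (S m)) - harmonic m.
Proof.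
  unfold harmonic. rewrite !S_INR. simpl pow.
  set (t := (2 * (INR m + 1) + 1) * theta).
  replace ((2 * (INR m + 1 + 1) + 1) * theta) with (t + 2 * theta) by (unfold t; ring).
  replace ((2 * INR m + 1) * theta) with (t - 2 * theta) by (unfold t; ring).
  rewrite cos_plus, cos_minus. ring.
Qed.

Lemma harmonic_abs_le (m : nat) : Rabs (harmonic m) <= 1.
Proof.
  unfold harmonic. rewrite Rabs_mult, pow_1_abs, Rmult_1_l.
  apply Rabs_le, COS_bound.
Qed.

(** The differential equation for the M-th partial sum of S, read on coefficients. Summation by
    parts moves the shifts of m from [i_coef] onto [harmonic], where they become the factor -2 cos
    (2 theta); the last bracket is the boundary term at M. *)
Lemma sum_harmonic_rec (n M : nat) :
  (2 * INR n + 3) * sum_f_R0 (fun m => harmonic m * i_coef (S n) m) M =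
  harmonic 0 / INR (fact (S n))
  - 2 * cos (2 * theta) * sum_f_R0 (fun m => harmonic m * i_coef n m) M
  + (harmonic M * i_coef n (S M) - harmonic (S M) * i_coef n M).
Proof.
  induction M as [|M IH].
  - cbn [sum_f_R0]. pose proof (i_coef_rec_0 n) as E. pose proof harmonic_rec_0 as H.
    replace ((2 * INR n + 3) * (harmonic 0 * i_coef (S n) 0)) with
      (harmonic 0 * ((2 * INR n + 3) * i_coef (S n) 0)) by ring.
    rewrite E. unfold Rdiv.
    replace (2 * cos (2 * theta) * (harmonic 0 * i_coef n 0))
      with (2 * cos (2 * theta) * harmonic 0 * i_coef n 0) by ring.
    rewrite H. ring.
  - rewrite (tech5 (fun m => harmonic m * i_coef (S n) m)),
      (tech5 (fun m => harmonic m * i_coef n m)), Rmult_plus_distr_l, IH.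
    replace ((2 * INR n + 3) * (harmonic (S M) * i_coef (S n) (S M))) with
      (harmonic (S M) * ((2 * INR n + 3) * i_coef (S n) (S M))) by ring.
    rewrite i_coef_rec_S.
    rewrite (Rmult_plus_distr_l (2 * cos (2 * theta))).
    replace (2 * cos (2 * theta) * (harmonic (S M) * i_coef n (S M)))
      with (2 * cos (2 * theta) * harmonic (S M) * i_coef n (S M)) by ring.
    rewrite harmonic_rec_S. ring.
Qed.

Lemma sum_harmonic_abs_le (n M : nat) :
  Rabs (sum_f_R0 (fun m => harmonic m * i_coef n m) M) <= / INR (fact n).
Proof.
  eapply Rle_trans; [apply Rsum_abs|]. eapply Rle_trans; [|apply (sum_i_coef_le n M)].
  apply sum_Rle. intros k _. rewrite Rabs_mult, (Rabs_pos_eq (i_coef n k)) by apply i_coef_ge_0.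
  pose proof (harmonic_abs_le k). pose proof (i_coef_ge_0 n k). nra.
Qed.

(** * Moments of the phase and the coefficients of the Dawson side *)

Definition phase (s : R) : R := s ^ 2 * (1 + cos (2 * theta)) - cos (2 * theta).

(** With q for [phase], s q' = 2 (q + cos (2 theta)), so the derivative involves only powers of
    q. *)
Lemma is_derive_phase_pow (n : nat) (s : R) :
  is_derive (fun s => s * phase s ^ S n) s
    ((2 * INR n + 3) * phase s ^ S n + 2 * INR (S n) * cos (2 * theta) * phase s ^ n).
Proof.
  unfold phase. auto_derive; [exact I|].
  change (match n with O => 1 | S _ => INR n + 1 end) with (INR (S n)).
  rewrite S_INR, <- tech_pow_Rmult.
  replace (s * (s * 1) * (1 + cos (2 * theta)) + - cos (2 * theta))
    with (s ^ 2 * (1 + cos (2 * theta)) - cos (2 * theta)) by ring.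
  ring.
Qed.

Lemma continuous_phase_pow (n : nat) (s : R) : continuous (fun s => phase s ^ n) s.
Proof.
  apply (ex_derive_continuous (fun s => phase s ^ n)).
  unfold phase. auto_derive. exact I.
Qed.

Lemma phase_1 : phase 1 = 1.
Proof. unfold phase. ring. Qed.

(** The value is the convex combination of 1 and -cos (2 theta) with weights s^2 and 1 - s^2. *)
Lemma phase_abs_le (s : R) : 0 <= s <= 1 -> Rabs (phase s) <= 1.
Proof.
  intros H. unfold phase. pose proof (COS_bound (2 * theta)).
  assert (0 <= s ^ 2 <= 1) by nra. apply Rabs_le. nra.
Qed.

Definition phase_moment (n : nat) : R := RInt (fun s => phase s ^ n) 0 1.

Lemma is_RInt_phase_pow (n : nat) :
  is_RInt (fun s => phase s ^ n) 0 1 (phase_moment n).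
Proof.
  apply (RInt_correct (fun s => phase s ^ n)), (ex_RInt_continuous (fun s => phase s ^ n)).
  intros s _. apply continuous_phase_pow.
Qed.

Lemma phase_moment_rec (n : nat) :
  (2 * INR n + 3) * phase_moment (S n)
  + 2 * INR (S n) * cos (2 * theta) * phase_moment n = 1.
Proof.
  assert (A : is_RInt (fun s => (2 * INR n + 3) * phase s ^ S n
                + 2 * INR (S n) * cos (2 * theta) * phase s ^ n) 0 1
     ((2 * INR n + 3) * phase_moment (S n)
      + 2 * INR (S n) * cos (2 * theta) * phase_moment n)).
  { apply (is_RInt_plus (V := R_NormedModule));
      apply (is_RInt_scal (V := R_NormedModule)); apply is_RInt_phase_pow. }
  assert (B : is_RInt (fun s => (2 * INR n + 3) * phase s ^ S n
                + 2 * INR (S n) * cos (2 * theta) * phase s ^ n) 0 1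
              (1 * phase 1 ^ S n - 0 * phase 0 ^ S n)).
  { apply (is_RInt_derive (fun s => s * phase s ^ S n)).
    - intros s _. apply is_derive_phase_pow.
    - intros s _. apply (continuous_plus (V := R_NormedModule));
        apply (continuous_mult (K := R_AbsRing));
        first [apply continuous_const | apply continuous_phase_pow]. }
  apply (is_RInt_unique (V := R_CompleteNormedModule)) in A, B.
  rewrite <- A, B, phase_1, pow1. ring.
Qed.

Definition dawson_coef (n : nat) : R :=
  cos theta / INR (fact n) * phase_moment n.

Lemma dawson_coef_0 : dawson_coef 0 = cos theta.
Proof.
  unfold dawson_coef, phase_moment. simpl. rewrite RInt_const. unfold scal; simpl; unfold mult; simpl.
  field.
Qed.

Lemma dawson_coef_rec (n : nat) :
  (2 * INR n + 3) * dawson_coef (S n) =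
  cos theta / INR (fact (S n)) - 2 * cos (2 * theta) * dawson_coef n.
Proof.
  unfold dawson_coef.
  replace (cos theta / INR (fact n)) with (INR (S n) * (cos theta / INR (fact (S n)))).
  - pose proof (phase_moment_rec n) as E.
    set (a := cos theta / INR (fact (S n))).
    rewrite <- (Rmult_1_r a) at 2. revert E.
    generalize (phase_moment (S n)) (phase_moment n). intros p q <-. ring.
  - rewrite fact_simpl, mult_INR. field. split; [apply INR_fact_neq_0 | apply not_0_INR; lia].
Qed.

(** Both sides start at cos theta and obey the same recurrence with nonzero leading factor 2n + 3.
    In the step from n to n + 1 <= M, the boundary term vanishes because [i_coef n M] and
    [i_coef n (S M)] lie beyond the degree n. *)
Lemma sum_harmonic_eq (n M : nat) :
  (n <= M)%nat -> sum_f_R0 (fun m => harmonic m * i_coef n m) M = dawson_coef n.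
Proof.
  induction n as [|n IH]; intros H.
  - rewrite dawson_coef_0. clear H.
    induction M as [|M IHM]; [simpl; rewrite harmonic_0; ring|].
    rewrite tech5, IHM. simpl. ring.
  - pose proof (pos_INR n).
    apply (Rmult_eq_reg_l (2 * INR n + 3)); [|lra].
    rewrite sum_harmonic_rec, dawson_coef_rec, IH, harmonic_0 by lia.
    rewrite (proj1 (i_coef_closed n (S M))), (proj1 (i_coef_closed n M)) by lia. ring.
Qed.

End Harmonics.

(** * The Gamma function at half-integers *)

Definition gauss_int (u : R) : R := RInt (fun s => exp (- s ^ 2)) 0 u.

Lemma continuous_gauss (s : R) : continuous (fun s => exp (- s ^ 2)) s.
Proof.
  apply (ex_derive_continuous (fun s => exp (- s ^ 2))). auto_derive. exact I.
Qed.

Lemma ex_RInt_gauss (a b : R) : ex_RInt (fun s => exp (- s ^ 2)) a b.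
Proof.
  apply (ex_RInt_continuous (fun s => exp (- s ^ 2))). intros s _. apply continuous_gauss.
Qed.

Lemma is_derive_gauss_int (u : R) : is_derive gauss_int u (exp (- u ^ 2)).
Proof.
  apply (is_derive_RInt (fun s => exp (- s ^ 2)) gauss_int 0 u).
  - apply filter_forall. intros b.
    apply (RInt_correct (fun s => exp (- s ^ 2))), ex_RInt_gauss.
  - apply continuous_gauss.
Qed.

Lemma gauss_int_0 : gauss_int 0 = 0.
Proof. apply (RInt_point 0 (fun s => exp (- s ^ 2))). Qed.

Lemma gauss_int_ge_0 (u : R) : 0 <= u -> 0 <= gauss_int u.
Proof.
  intros Hu. apply RInt_ge_0; [exact Hu | apply ex_RInt_gauss|].
  intros x _. left. apply exp_pos.
Qed.

(* With [gauss_param u = int_0^1 exp (- u^2 (1 + t^2)) / (1 + t^2) dt], the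
   function [gauss_int u ^ 2 + gauss_param u] has zero derivative. *)
Definition gauss_param_fun (u t : R) : R := exp (- u ^ 2 * (1 + t ^ 2)) / (1 + t ^ 2).

Definition gauss_param (u : R) : R := RInt (fun t => gauss_param_fun u t) 0 1.

Lemma is_derive_gauss_param_fun (u t : R) :
  is_derive (fun z => gauss_param_fun z t) u (- 2 * u * exp (- u ^ 2 * (1 + t ^ 2))).
Proof.
  unfold gauss_param_fun. auto_derive; [nra|]. simpl. field. nra.
Qed.

Lemma ex_RInt_gauss_param_fun (u : R) : ex_RInt (fun t => gauss_param_fun u t) 0 1.
Proof.
  apply (ex_RInt_continuous (fun t => gauss_param_fun u t)). intros t _.
  apply (ex_derive_continuous (fun t => gauss_param_fun u t)).
  unfold gauss_param_fun. auto_derive. nra.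
Qed.

Lemma continuity_2d_gauss (u t : R) :
  continuity_2d_pt (fun u v => - 2 * u * exp (- u ^ 2 * (1 + v ^ 2))) u t.
Proof.
  apply continuity_2d_pt_mult.
  - apply continuity_2d_pt_mult; [apply continuity_2d_pt_const | apply continuity_2d_pt_id1].
  - apply (continuity_1d_2d_pt_comp exp (fun u v => - u ^ 2 * (1 + v ^ 2))).
    + apply derivable_continuous_pt, derivable_pt_exp.
    + apply continuity_2d_pt_ext with (fun u v => - (u * u) * (1 + v * v)).
      { intros x y. ring. }
      apply continuity_2d_pt_mult.
      * apply continuity_2d_pt_opp, continuity_2d_pt_mult; apply continuity_2d_pt_id1.
      * apply continuity_2d_pt_plus; [apply continuity_2d_pt_const|].
        apply continuity_2d_pt_mult; apply continuity_2d_pt_id2.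
Qed.

Lemma is_derive_gauss_param (u : R) :
  is_derive gauss_param u (- 2 * exp (- u ^ 2) * gauss_int u).
Proof.
  assert (D : forall z t, Derive (fun z => gauss_param_fun z t) z
                          = - 2 * z * exp (- z ^ 2 * (1 + t ^ 2))).
  { intros z t. apply is_derive_unique, is_derive_gauss_param_fun. }
  replace (- 2 * exp (- u ^ 2) * gauss_int u)
    with (RInt (fun t => Derive (fun z => gauss_param_fun z t) u) 0 1).
  - apply is_derive_RInt_param.
    + apply filter_forall. intros z t _. eexists. apply is_derive_gauss_param_fun.
    + intros t _. eapply continuity_2d_pt_ext; [|apply continuity_2d_gauss].
      intros z v. symmetry. apply D.
    + apply filter_forall. intros z. apply ex_RInt_gauss_param_fun.
  - apply is_RInt_unique.
    (* Splitting exp (-u^2 (1 + t^2)) prepares the substitution s = u t, which turns the integral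
       over [0, 1] into [gauss_int u]; the summand 0 fits the form of an affine change of
       variable. *)
    apply is_RInt_ext with (fun t => scal (- 2 * exp (- u ^ 2)) (scal u (exp (- (u * t + 0) ^ 2)))).
    { intros t _. rewrite D. unfold scal; simpl; unfold mult; simpl.
      replace (- (u * (u * 1)) * (1 + t * (t * 1)))
        with (- (u * (u * 1)) + - ((u * t + 0) * ((u * t + 0) * 1))) by ring.
      rewrite exp_plus. ring. }
    apply (is_RInt_scal (V := R_NormedModule)).
    apply (is_RInt_comp_lin (V := R_NormedModule) (fun s => exp (- s ^ 2)) u 0 0 1).
    replace (u * 0 + 0) with 0 by ring. replace (u * 1 + 0) with u by ring.
    apply (RInt_correct (fun s => exp (- s ^ 2))), ex_RInt_gauss.
Qed.

Lemma gauss_param_0 : gauss_param 0 = PI / 4.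
Proof.
  apply (is_RInt_unique (V := R_CompleteNormedModule)).
  assert (E : forall t, / (1 + Rsqr t) = gauss_param_fun 0 t).
  { intros t. unfold gauss_param_fun, Rsqr.
    replace (- 0 ^ 2 * (1 + t ^ 2)) with 0 by ring. rewrite exp_0.
    replace (t ^ 2) with (t * t) by ring. field. nra. }
  apply is_RInt_ext with (fun t => / (1 + Rsqr t)); [intros t _; apply E|].
  replace (PI / 4) with (minus (atan 1) (atan 0)).
  - apply (is_RInt_derive (V := R_CompleteNormedModule) atan).
    + intros x _. apply is_derive_atan.
    + intros x _. apply (ex_derive_continuous (fun t => / (1 + Rsqr t))).
      unfold Rsqr. auto_derive. nra.
  - rewrite atan_1, atan_0. unfold minus, plus, opp; simpl. ring.
Qed.

Lemma gauss_int_sqr (u : R) : 0 <= u -> gauss_int u ^ 2 + gauss_param u = PI / 4.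
Proof.
  intros [Hu|<-].
  2:{ rewrite gauss_int_0, gauss_param_0. ring. }
  rewrite <- (Rplus_0_l (PI / 4)), <- gauss_param_0.
  transitivity (gauss_int 0 ^ 2 + gauss_param 0).
  2:{ rewrite gauss_int_0. ring. }
  symmetry. apply (eq_is_derive (fun u => gauss_int u ^ 2 + gauss_param u) 0 u); [|exact Hu].
  intros t _.
  change (is_derive (fun u => gauss_int u ^ 2 + gauss_param u) t 0).
  replace 0 with (2 * exp (- t ^ 2) * gauss_int t + - 2 * exp (- t ^ 2) * gauss_int t)
    by ring.
  apply (is_derive_plus (K := R_AbsRing) (V := R_NormedModule));
    [|apply is_derive_gauss_param].
  replace (2 * exp (- t ^ 2) * gauss_int t)
    with (INR 2 * exp (- t ^ 2) * gauss_int t ^ pred 2) by (simpl; ring).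
  apply is_derive_pow, is_derive_gauss_int.
Qed.

Lemma gauss_param_bound (u : R) : 0 <= gauss_param u <= exp (- u ^ 2).
Proof.
  assert (B : forall t, 0 <= gauss_param_fun u t <= exp (- u ^ 2)).
  { intros t. unfold gauss_param_fun.
    assert (0 < / (1 + t ^ 2)) by (apply Rinv_0_lt_compat; nra).
    assert (/ (1 + t ^ 2) <= 1) by (rewrite <- Rinv_1; apply Rinv_le_contravar; nra).
    assert (exp (- u ^ 2 * (1 + t ^ 2)) <= exp (- u ^ 2)).
    { assert (- u ^ 2 * (1 + t ^ 2) <= - u ^ 2) as [L|E].
      - assert (0 <= u ^ 2 * t ^ 2) by (apply Rmult_le_pos; nra). lra.
      - left; now apply exp_increasing.
      - rewrite E; lra. }
    pose proof (exp_pos (- u ^ 2 * (1 + t ^ 2))). pose proof (exp_pos (- u ^ 2)).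
    unfold Rdiv. nra. }
  split.
  - apply RInt_ge_0; [lra | apply ex_RInt_gauss_param_fun|]. intros x _. apply B.
  - replace (exp (- u ^ 2)) with (RInt (fun _ : R => exp (- u ^ 2)) 0 1).
    + apply RInt_le; [lra | apply ex_RInt_gauss_param_fun | apply ex_RInt_const|].
      intros x _. apply B.
    + rewrite RInt_const. unfold scal; simpl; unfold mult; simpl. ring.
Qed.

Lemma pow_le_exp (n : nat) (t : R) : 0 <= t -> t ^ n / INR (fact n) <= exp t.
Proof.
  intros Ht. eapply Rle_trans; [|apply (exp_ge_taylor t n Ht)].
  destruct n as [|n]; [simpl; lra|]. rewrite tech5.
  assert (0 <= sum_f_R0 (fun k => t ^ k / INR (fact k)) n); [|lra].
  apply cond_pos_sum. intros k.
  apply Rmult_le_pos; [now apply pow_le | left; apply Rinv_0_lt_compat, INR_fact_lt_0].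
Qed.

(** The square of [gauss_int u] is PI / 4 minus [gauss_param u], and the latter tends to 0. *)
Lemma is_lim_gauss_int : is_lim gauss_int p_infty (sqrt PI / 2).
Proof.
  assert (HP : is_lim gauss_param p_infty 0).
  { apply (is_lim_le_le_loc (fun _ => 0) (fun u => / u)).
    - exists 1. intros u Hu. destruct (gauss_param_bound u) as [H0 H1].
      split; [exact H0|]. eapply Rle_trans; [exact H1|].
      rewrite exp_Ropp. apply Rinv_le_contravar; [lra|].
      pose proof (exp_ineq1_le (u ^ 2)). nra.
    - apply is_lim_const.
    - apply (is_lim_inv (fun u => u) p_infty p_infty); [apply is_lim_id | discriminate]. }
  apply (is_lim_ext_loc (fun u => sqrt (PI / 4 - gauss_param u))).
  - exists 0. intros u Hu. rewrite <- (gauss_int_sqr u) by lra.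
    replace (gauss_int u ^ 2 + gauss_param u - gauss_param u) with (gauss_int u ^ 2) by ring.
    apply sqrt_pow2, gauss_int_ge_0. lra.
  - replace (sqrt PI / 2) with (sqrt (PI / 4 - 0)).
    + apply (is_lim_comp_continuous (fun u => PI / 4 - gauss_param u) sqrt p_infty (PI / 4 - 0)).
      * apply (is_lim_minus' (fun _ => PI / 4)); [apply is_lim_const | exact HP].
      * apply continuous_sqrt.
    + rewrite Rminus_0_r. pose proof PI_RGT_0.
      rewrite sqrt_div_alt by lra.
      replace 4 with (2 ^ 2) by ring. rewrite sqrt_pow2 by lra. reflexivity.
Qed.

(* Antiderivative of [t^(n + 1/2) exp (- t)] on [t > 0], vanishing at 0. *)
Fixpoint gamma_primitive (n : nat) (t : R) : R :=
  match n with
  | O => gauss_int (sqrt t) - sqrt t * exp (- t)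
  | S k => (INR k + 3 / 2) * gamma_primitive k t - t ^ S k * sqrt t * exp (- t)
  end.

Lemma continuous_pow_sqrt_exp (k : nat) (t : R) :
  continuous (fun t => t ^ k * sqrt t * exp (- t)) t.
Proof.
  apply (continuous_mult (K := R_AbsRing) (fun t => t ^ k * sqrt t)).
  - apply (continuous_mult (K := R_AbsRing) (fun t => t ^ k)); [|apply continuous_sqrt].
    apply (ex_derive_continuous (fun t => t ^ k)). auto_derive. exact I.
  - apply (ex_derive_continuous (fun t => exp (- t))). auto_derive. exact I.
Qed.

(** Continuity holds on the whole line, [sqrt] being 0 at negative arguments, so the right limit at
    0 needed for Euler's integral is the value at 0. *)
Lemma continuous_gamma_primitive (n : nat) (t : R) : continuous (gamma_primitive n) t.
Proof.
  induction n as [|n IH]; cbn [gamma_primitive].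
  - apply (continuous_minus (V := R_NormedModule)).
    + apply (continuous_comp sqrt gauss_int); [apply continuous_sqrt|].
      apply (ex_derive_continuous gauss_int). eexists. apply is_derive_gauss_int.
    + apply (continuous_ext (fun t => t ^ 0 * sqrt t * exp (- t))).
      * intros x. simpl. now rewrite Rmult_1_l.
      * apply continuous_pow_sqrt_exp.
  - apply (continuous_minus (V := R_NormedModule)); [|apply continuous_pow_sqrt_exp].
    apply (continuous_mult (K := R_AbsRing) (fun _ => INR n + 3 / 2)); [apply continuous_const | exact IH].
Qed.

Lemma gamma_primitive_0 (n : nat) : gamma_primitive n 0 = 0.
Proof.
  induction n as [|n IH]; cbn [gamma_primitive].
  - rewrite sqrt_0, gauss_int_0. ring.
  - rewrite IH. simpl. ring.
Qed.

(** The recursion is integration by parts: (n + 3/2) t^n sqrt t exp (-t) cancels the part of the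
    product rule that differentiates t^(n+1) sqrt t. For n = 0 the same cancellation is between the
    two terms exp (-t) / (2 sqrt t). *)
Lemma is_derive_gamma_primitive (n : nat) (t : R) :
  0 < t -> is_derive (gamma_primitive n) t (t ^ n * sqrt t * exp (- t)).
Proof.
  intros Ht. pose proof (sqrt_lt_R0 t Ht) as Hs. pose proof (sqrt_sqrt t (Rlt_le _ _ Ht)) as Hss.
  assert (Ds : is_derive sqrt t (/ (2 * sqrt t))).
  { auto_derive; [exact Ht|]. field. lra. }
  assert (De : is_derive (fun t : R => exp (- t)) t (- exp (- t))).
  { auto_derive; [exact I|]. ring. }
  induction n as [|n IH]; cbn [gamma_primitive].
  - replace (t ^ 0 * sqrt t * exp (- t))
      with (/ (2 * sqrt t) * exp (- sqrt t ^ 2)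
            - (/ (2 * sqrt t) * exp (- t) + sqrt t * - exp (- t))).
    2:{ replace (sqrt t ^ 2) with t by (rewrite <- Hss at 1; ring). simpl. field. lra. }
    apply (is_derive_minus (K := R_AbsRing) (V := R_NormedModule)).
    + apply (is_derive_comp (K := R_AbsRing) (V := R_NormedModule) gauss_int sqrt);
        [apply is_derive_gauss_int | exact Ds].
    + exact (is_derive_mult (K := R_AbsRing) sqrt (fun t : R => exp (- t)) t _ _
               Ds De Rmult_comm).
  - replace (t ^ S n * sqrt t * exp (- t))
      with ((INR n + 3 / 2) * (t ^ n * sqrt t * exp (- t))
            - ((INR (S n) * t ^ n * sqrt t + t ^ S n * / (2 * sqrt t)) * exp (- t)
               + t ^ S n * sqrt t * - exp (- t))).
    2:{ rewrite S_INR. replace (t ^ S n * / (2 * sqrt t)) with (t ^ n * sqrt t / 2).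
        - change (t ^ S n) with (t * t ^ n). field.
        - replace (t ^ S n) with (t ^ n * (sqrt t * sqrt t)) by (rewrite Hss; simpl; ring).
          field. lra. }
    apply (is_derive_minus (K := R_AbsRing) (V := R_NormedModule)).
    + apply is_derive_scal, IH.
    + refine (is_derive_mult (K := R_AbsRing) (fun t : R => t ^ S n * sqrt t)
                (fun t : R => exp (- t)) t _ _ _ De Rmult_comm).
      refine (is_derive_mult (K := R_AbsRing) (fun t : R => t ^ S n) sqrt t _ _ _
                Ds Rmult_comm).
      auto_derive; [exact I|].
      change (match n with O => 1 | S _ => INR n + 1 end) with (INR (S n)). simpl pred. ring.
Qed.

Lemma is_lim_pow_sqrt_exp (k : nat) :
  is_lim (fun t => t ^ k * sqrt t * exp (- t)) p_infty 0.
Proof.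
  (* For t > 1, sqrt t <= t, and t^(k+2) / (k+2)! <= exp t bounds t^(k+1) exp (-t) by (k+2)! / t. *)
  apply (is_lim_le_le_loc (fun _ => 0) (fun t => INR (fact (k + 2)) * / t)).
  - exists 1. intros t Ht.
    assert (P : 0 < t ^ k) by (apply pow_lt; lra).
    assert (Q : 0 <= sqrt t <= t).
    { split; [apply sqrt_pos|]. rewrite <- (sqrt_Rsqr t) at 2 by lra.
      apply sqrt_le_1_alt. unfold Rsqr. nra. }
    pose proof (exp_pos (- t)) as rho.
    split; [apply Rmult_le_pos; [apply Rmult_le_pos; lra | lra]|].
    apply Rle_trans with (t ^ k * t * exp (- t)).
    { apply Rmult_le_compat_r; [lra|]. apply Rmult_le_compat_l; lra. }
    pose proof (pow_le_exp (k + 2) t ltac:(lra)) as B.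
    apply (Rmult_le_reg_r (exp t * t)); [apply Rmult_lt_0_compat; [apply exp_pos | lra]|].
    replace (t ^ k * t * exp (- t) * (exp t * t)) with (t ^ (k + 2) * (exp (- t) * exp t))
      by (rewrite pow_add; ring).
    rewrite <- exp_plus, Rplus_opp_l, exp_0.
    apply Rle_trans with (INR (fact (k + 2)) * exp t); [|right; field; lra].
    apply (Rmult_le_compat_l (INR (fact (k + 2)))) in B; [|apply pos_INR].
    eapply Rle_trans; [|exact B]. right. field. apply INR_fact_neq_0.
  - apply is_lim_const.
  - replace (Finite 0) with (Rbar_mult (INR (fact (k + 2))) 0) by (simpl; f_equal; ring).
    apply is_lim_scal_l.
    apply (is_lim_inv (fun u => u) p_infty p_infty); [apply is_lim_id | discriminate].
Qed.

Lemma odd_dfact_S_half (n : nat) :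
  odd_dfact (S n) / 2 ^ S n = (INR n + 3 / 2) * (odd_dfact n / 2 ^ n).
Proof.
  simpl. field. apply pow_nonzero. lra.
Qed.

Lemma is_lim_gamma_primitive (n : nat) :
  is_lim (gamma_primitive n) p_infty (sqrt PI / 2 * (odd_dfact n / 2 ^ n)).
Proof.
  induction n as [|n IH].
  - replace (sqrt PI / 2 * (odd_dfact 0 / 2 ^ 0)) with (sqrt PI / 2 - 0) by (simpl; field).
    apply (is_lim_minus' (fun t => gauss_int (sqrt t)) (fun t => sqrt t * exp (- t))).
    + eapply filterlim_comp; [apply filterlim_sqrt_p | apply is_lim_gauss_int].
    + apply (is_lim_ext (fun t => t ^ 0 * sqrt t * exp (- t))).
      * intros x. simpl. now rewrite Rmult_1_l.
      * apply is_lim_pow_sqrt_exp.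
  - rewrite odd_dfact_S_half.
    replace (sqrt PI / 2 * ((INR n + 3 / 2) * (odd_dfact n / 2 ^ n)))
      with ((INR n + 3 / 2) * (sqrt PI / 2 * (odd_dfact n / 2 ^ n)) - 0) by ring.
    apply (is_lim_minus' (fun t => (INR n + 3 / 2) * gamma_primitive n t)
             (fun t => t ^ S n * sqrt t * exp (- t))).
    + apply (is_lim_scal_l (gamma_primitive n) (INR n + 3 / 2) p_infty
               (sqrt PI / 2 * (odd_dfact n / 2 ^ n)) IH).
    + apply is_lim_pow_sqrt_exp.
Qed.

Lemma Rpower_half_integer (n : nat) (t : R) :
  0 < t -> Rpower t (INR n + 3 / 2 - 1) = t ^ n * sqrt t.
Proof.
  intros Ht. replace (INR n + 3 / 2 - 1) with (INR n + / 2) by field.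
  now rewrite Rpower_plus, Rpower_pow, Rpower_sqrt.
Qed.

Lemma Gamma_half_integer (n : nat) :
  Gamma (INR n + 3 / 2) = sqrt PI / 2 * (odd_dfact n / 2 ^ n).
Proof.
  (* Eventually both endpoints are positive, so every point of the interval lies where the primitive
     is differentiable and [Rpower] has its usual meaning. *)
  assert (Hpos : filter_prod (at_right 0) (Rbar_locally p_infty)
    (fun ab : R * R => forall t, Rmin (fst ab) (snd ab) <= t -> 0 < t)).
  { apply (Filter_prod _ _ _ (fun a => 0 < a) (fun b => 0 < b)).
    - exists (mkposreal 1 Rlt_0_1). intros y _ Hy. exact Hy.
    - exists 0. trivial.
    - intros a b Ha Hb t Ht. simpl in Ht.
      apply Rlt_le_trans with (2 := Ht). now apply Rmin_glb_lt. }
  assert (D : forall t, 0 < t -> Derive (gamma_primitive n) t = t ^ n * sqrt t * exp (- t)).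
  { intros t Ht. now apply is_derive_unique, is_derive_gamma_primitive. }
  unfold Gamma. apply (is_RInt_gen_unique (V := R_CompleteNormedModule)
    (fun t => Rpower t (INR n + 3 / 2 - 1) * exp (- t))).
  apply (is_RInt_gen_ext (V := R_NormedModule) (Derive (gamma_primitive n))).
  { revert Hpos. apply filter_imp. intros [a b] Hab t Ht.
    assert (Pt : 0 < t) by (apply Hab; left; apply Ht).
    rewrite D, Rpower_half_integer by exact Pt. reflexivity. }
  set (l := sqrt PI / 2 * (odd_dfact n / 2 ^ n)).
  (* The value is written as the limit at infinity minus the limit at 0. *)
  cut (is_RInt_gen (V := R_NormedModule) (Derive (gamma_primitive n))
         (at_right 0) (Rbar_locally p_infty) (l - 0)).
  { now rewrite Rminus_0_r. }
  apply is_RInt_gen_Derive.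
  - revert Hpos. apply filter_imp. intros ab Hab t Ht. eexists.
    apply is_derive_gamma_primitive, Hab, Ht.
  - revert Hpos. apply filter_imp. intros ab Hab t Ht.
    assert (Pt : 0 < t) by apply Hab, Ht.
    apply (continuous_ext_loc _ (fun t => t ^ n * sqrt t * exp (- t)));
      [|apply continuous_pow_sqrt_exp].
    exists (mkposreal t Pt). intros y Hy. symmetry. apply D.
    change (Rabs (y - t) < t) in Hy. apply Rabs_lt_between in Hy. lra.
  - rewrite <- (gamma_primitive_0 n) at 2.
    eapply filterlim_filter_le_1; [|apply (continuous_gamma_primitive n 0)].
    intros P [d HP]. exists d. intros y Hy _. now apply HP.
  - apply is_lim_gamma_primitive.
Qed.

(** * The entire extension of the spherical Bessel functions *)

Lemma RtoC_neq (x y : R) : x <> y -> RtoC x <> RtoC y.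
Proof. intros H E. now apply H, RtoC_inj. Qed.

Lemma Cinv_neq_0 (z : C) : z <> 0 -> (/ z)%C <> 0.
Proof.
  intros Hz E. apply C1_nz. rewrite <- (Cinv_r z Hz), E. ring.
Qed.

Lemma Re_div_Cmod_bound (z : C) : z <> 0 -> -1 <= Re z / Cmod z <= 1.
Proof.
  intros Hz. apply Cmod_gt_0 in Hz. apply Rabs_le_between.
  unfold Rdiv. rewrite Rabs_mult, (Rabs_pos_eq (/ _)) by (left; now apply Rinv_0_lt_compat).
  apply Rmult_le_reg_r with (Cmod z); [exact Hz|].
  rewrite Rmult_assoc, Rinv_l by lra. pose proof (re_le_Cmod z). lra.
Qed.

Lemma cos_Carg (z : C) : z <> 0 -> cos (Carg z) = Re z / Cmod z.
Proof.
  intros Hz. unfold Carg. destruct (Rle_dec 0 (Im z)); rewrite ?cos_neg;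
    apply cos_acos, Re_div_Cmod_bound, Hz.
Qed.

Lemma sin_Carg (z : C) : z <> 0 -> sin (Carg z) = Im z / Cmod z.
Proof.
  intros Hz. pose proof (Re_div_Cmod_bound z Hz) as B. apply Cmod_gt_0 in Hz.
  assert (E : sqrt (1 - Rsqr (Re z / Cmod z)) = Rabs (Im z) / Cmod z).
  { replace (1 - Rsqr (Re z / Cmod z)) with (Rsqr (Im z / Cmod z)).
    - rewrite sqrt_Rsqr_abs. unfold Rdiv.
      rewrite Rabs_mult, (Rabs_pos_eq (/ _)); [reflexivity|].
      left; now apply Rinv_0_lt_compat.
    - pose proof (Cmod2_alt z) as M. unfold Rsqr.
      apply Rmult_eq_reg_r with (Cmod z ^ 2); [|apply pow_nonzero; lra].
      replace ((1 - Re z / Cmod z * (Re z / Cmod z)) * Cmod z ^ 2)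
        with (Cmod z ^ 2 - Re z ^ 2) by (field; lra).
      rewrite M at 2. field. lra. }
  unfold Carg. destruct (Rle_dec 0 (Im z)) as [P|N].
  - rewrite sin_acos, E, Rabs_pos_eq; trivial.
  - rewrite sin_neg, sin_acos, E, Rabs_left by (trivial; lra). field. lra.
Qed.

Lemma Cexp_Clog (z : C) : z <> 0 -> Cexp (Clog z) = z.
Proof.
  intros Hz. unfold Cexp, Clog. simpl. rewrite cos_Carg, sin_Carg by exact Hz.
  apply Cmod_gt_0 in Hz. rewrite exp_ln by exact Hz.
  destruct z as [x y]. simpl. f_equal; field; lra.
Qed.

Lemma Carg_scale (r : R) (z : C) : 0 < r -> z <> 0 -> Carg (r * z) = Carg z.
Proof.
  intros Hr Hz. unfold Carg.
  assert (E : Re (r * z) / Cmod (r * z) = Re z / Cmod z).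
  { apply Cmod_gt_0 in Hz. rewrite Cmod_mult, Cmod_R, Rabs_pos_eq by lra.
    replace (Re (r * z)) with (r * Re z) by (destruct z; simpl; ring). field. lra. }
  rewrite E. replace (Im (r * z)) with (r * Im z) by (destruct z; simpl; ring).
  destruct (Rle_dec 0 (Im z)), (Rle_dec 0 (r * Im z)); trivial; exfalso; nra.
Qed.

Lemma slit_plane_neq_0 (z : C) : slit_plane z -> z <> 0.
Proof. intros [H|H] ->; simpl in H; lra. Qed.

Lemma Carg_conj (z : C) : slit_plane z -> Carg (Cconj z) = - Carg z.
Proof.
  intros Hz. pose proof (slit_plane_neq_0 z Hz) as H0. apply Cmod_gt_0 in H0.
  unfold Carg. rewrite Cmod_conj.
  change (Im (Cconj z)) with (- Im z). change (Re (Cconj z)) with (Re z).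
  destruct (Rle_dec 0 (Im z)), (Rle_dec 0 (- Im z)); try lra.
  (* Both sign tests succeed only on the real axis; there the slit plane leaves the positive half,
     where the argument is 0. *)
  destruct Hz as [Hz|Hz]; [lra|].
  assert (Re z = Cmod z) as ->.
  { pose proof (Cmod2_alt z) as M. replace (Im z) with 0 in M by lra.
    apply Rsqr_inj; unfold Rsqr; nra. }
  replace (Cmod z / Cmod z) with 1 by (field; lra). rewrite acos_1. ring.
Qed.

Lemma Cconj_inv_scale (z : C) : z <> 0 -> (/ z)%C = (RtoC (/ Cmod z ^ 2) * Cconj z)%C.
Proof.
  intros Hz. pose proof (proj1 (Cmod_gt_0 z) Hz).
  rewrite RtoC_inv by (apply pow_nonzero; lra).
  rewrite Cmod2_conj. field. split; [|exact Hz].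
  intros E. apply Hz. rewrite <- (Cconj_conj z), E.
  unfold Cconj, RtoC. simpl. now rewrite Ropp_0.
Qed.

(** PI / (2z) is a positive multiple of the conjugate of z, so off the cut the two principal
    arguments are opposite and no multiple of 2 PI i appears. *)
Lemma Clog_inv_add (z : C) :
  slit_plane z -> (Clog (RtoC PI / (2 * z)) + Clog (z / 2))%C = RtoC (ln (PI / 4)).
Proof.
  intros Hz. pose proof (slit_plane_neq_0 z Hz) as H0.
  pose proof (proj1 (Cmod_gt_0 z) H0) as Hm. pose proof PI_RGT_0 as Hpi.
  assert (H2 : RtoC 2 <> 0) by (apply RtoC_neq; lra).
  assert (A1 : Carg (z / 2) = Carg z).
  { replace (z / 2)%C with (RtoC (/ 2) * z)%C by (rewrite RtoC_inv by lra; field; exact H2).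
    apply Carg_scale; [lra | exact H0]. }
  assert (A2 : Carg (RtoC PI / (2 * z)) = - Carg z).
  { replace (RtoC PI / (2 * z))%C with (RtoC (PI / 2 * / Cmod z ^ 2) * Cconj z)%C.
    - rewrite Carg_scale, Carg_conj; trivial.
      + apply Rmult_lt_0_compat; [lra|]. apply Rinv_0_lt_compat, pow_lt, Hm.
      + intros E. apply H0. rewrite <- (Cconj_conj z), E.
        unfold Cconj, RtoC. simpl. now rewrite Ropp_0.
    - rewrite RtoC_mult, <- Cmult_assoc, <- Cconj_inv_scale by exact H0.
      rewrite RtoC_div by lra. field. repeat split; trivial. }
  unfold Clog. rewrite A1, A2. apply injective_projections.
  2:{ change (- Carg z + Carg z = 0). ring. }
  change (ln (Cmod (RtoC PI / (2 * z))) + ln (Cmod (z / 2)) = ln (PI / 4)).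
  rewrite <- ln_mult.
  - f_equal. rewrite !Cmod_div, Cmod_mult, !Cmod_R, !Rabs_pos_eq by
      (lra || exact H2 || (apply Cmult_neq_0; trivial)).
    field. lra.
  - apply Cmod_gt_0, Cmult_neq_0; [now apply RtoC_neq; lra|].
    now apply Cinv_neq_0, Cmult_neq_0.
  - apply Cmod_gt_0, Cmult_neq_0; [exact H0 | now apply Cinv_neq_0].
Qed.

(** The two half powers combine into exp of half of ln (PI / 4), and the remaining integer power m
    carries no branch choice. *)
Lemma Csqrt_Cpower_half_integer (m : nat) (z : C) :
  slit_plane z ->
  (Csqrt (RtoC PI / (2 * z)) * Cpower (z / 2) (INR m + 1 / 2))%C
  = (RtoC (sqrt PI / 2) * (z / 2) ^ m)%C.
Proof.
  intros Hz. unfold Csqrt, Cpower. rewrite <- Cexp_add.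
  set (A := Clog (RtoC PI / (2 * z))). set (B := Clog (z / 2)).
  replace (RtoC (1 / 2) * A + RtoC (INR m + 1 / 2) * B)%C
    with (RtoC (1 / 2) * (A + B) + INR m * B)%C by (rewrite RtoC_plus; ring).
  unfold A, B. rewrite (Clog_inv_add z Hz).
  rewrite Cexp_add, Cexp_mult_INR, <- RtoC_mult, Cexp_RtoC, Cexp_Clog.
  - f_equal. f_equal. pose proof PI_RGT_0.
    replace (1 / 2 * ln (PI / 4)) with (ln (sqrt (PI / 4))).
    + rewrite exp_ln by (apply sqrt_lt_R0; lra).
      rewrite sqrt_div_alt by lra.
      replace 4 with (2 ^ 2) by ring. now rewrite sqrt_pow2 by lra.
    + rewrite <- Rpower_sqrt by lra. unfold Rpower. rewrite ln_exp. field.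
  - apply Cmult_neq_0; [now apply slit_plane_neq_0|].
    apply Cinv_neq_0, RtoC_neq. lra.
Qed.

(** * Power series and continuity of the entire extension *)

Definition sph_bessel_term (m : nat) (u : C) (k : nat) : C :=
  (RtoC ((-1) ^ k * bessel_coef m k) * u ^ k)%C.

Lemma ex_series_sph_bessel_term (m : nat) (u : C) : ex_series (sph_bessel_term m u).
Proof.
  apply ex_series_C_bound with (fun k => Cmod u ^ k / INR (fact k)).
  - intros k. unfold sph_bessel_term. rewrite Cmod_mult, Cmod_R, Cmod_pow.
    rewrite Rabs_mult, pow_1_abs, Rmult_1_l.
    rewrite Rabs_pos_eq by (left; apply bessel_coef_pos).
    unfold Rdiv. rewrite Rmult_comm.
    apply Rmult_le_compat_l; [apply pow_le, Cmod_ge_0 | apply bessel_coef_le].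
  - eexists. apply is_series_exp.
Qed.

Definition sph_bessel_entire (m : nat) (z : C) : C :=
  (z ^ m * CSeries (sph_bessel_term m (z ^ 2)))%C.

Lemma is_series_sph_bessel_term (m : nat) (u : C) :
  is_series (sph_bessel_term m u) (CSeries (sph_bessel_term m u)).
Proof.
  destruct (ex_series_sph_bessel_term m u) as [l Hl].
  now rewrite (CSeries_unique _ _ Hl).
Qed.

(** Gamma (m + k + 3/2) contributes 2^(m+k) in the numerator; together with 4^(-k) from (z/2)^(2k)
    this leaves the 2^(-k) of [bessel_coef] and the constant in front. *)
Lemma BesselJ_half_integer (m : nat) (z : C) :
  CSeries (fun k => RtoC ((-1) ^ k / (INR (fact k) * Gamma (INR m + 1 / 2 + INR k + 1)))
                    * (z / 2) ^ (2 * k))%C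
  = (RtoC (2 ^ m * 2 / sqrt PI) * CSeries (sph_bessel_term m (z ^ 2)))%C.
Proof.
  apply CSeries_unique.
  apply (is_series_ext (fun k => RtoC (2 ^ m * 2 / sqrt PI) * sph_bessel_term m (z ^ 2) k)%C).
  - intros k.
    replace (INR m + 1 / 2 + INR k + 1) with (INR (m + k) + 3 / 2) by (rewrite plus_INR; field).
    rewrite Gamma_half_integer. unfold sph_bessel_term, bessel_coef.
    rewrite Cpow_mult_r.
    replace ((z / 2) ^ 2)%C with (RtoC (/ 4) * z ^ 2)%C.
    2:{ rewrite RtoC_inv by lra. field. }
    rewrite Cpow_mult_l, !Cmult_assoc, <- RtoC_pow, <- !RtoC_mult.
    f_equal. f_equal.
    rewrite pow_inv, !pow_add.
    replace (4 ^ k) with (2 ^ k * 2 ^ k) by (rewrite <- Rpow_mult_distr; f_equal; ring).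
    pose proof (odd_dfact_pos (m + k)). pose proof (sqrt_lt_R0 PI PI_RGT_0).
    pose proof (INR_fact_lt_0 k). assert (0 < 2 ^ k) by (apply pow_lt; lra).
    assert (0 < 2 ^ m) by (apply pow_lt; lra).
    field. repeat split; lra.
  - apply is_series_C_mult, is_series_sph_bessel_term.
Qed.

Lemma sph_bessel_principal_entire (m : nat) (z : C) :
  slit_plane z -> sph_bessel_principal m z = sph_bessel_entire m z.
Proof.
  intros Hz. unfold sph_bessel_principal, BesselJ, sph_bessel_entire.
  rewrite BesselJ_half_integer, Cmult_assoc, Csqrt_Cpower_half_integer by exact Hz.
  rewrite Cmult_assoc. f_equal.
  pose proof (sqrt_lt_R0 PI PI_RGT_0).
  replace (z ^ m)%C with ((RtoC 2 * (z / 2)) ^ m)%C.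
  2:{ f_equal. field. }
  rewrite Cpow_mult_l, <- RtoC_pow.
  transitivity (RtoC (sqrt PI / 2 * (2 ^ m * 2 / sqrt PI)) * (z / 2) ^ m)%C.
  - rewrite RtoC_mult. ring.
  - f_equal. f_equal. field. lra.
Qed.

(** The coefficient of z^n in j_m. Where n < m or n - m is odd, [i_coef n m] is 0, so the truncated
    subtraction and the rounded division do no harm. *)
Definition entire_coef (m n : nat) : R := (-1) ^ ((n - m) / 2) * i_coef n m.

Lemma entire_coef_abs_le (m n : nat) : Rabs (entire_coef m n) <= / INR (fact n).
Proof.
  unfold entire_coef. rewrite Rabs_mult, pow_1_abs, Rmult_1_l.
  rewrite Rabs_pos_eq by apply i_coef_ge_0.
  eapply Rle_trans; [|apply (sum_i_coef_le n m)].
  destruct m as [|m]; [simpl; lra|]. rewrite tech5.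
  assert (0 <= sum_f_R0 (i_coef n) m) by (apply cond_pos_sum; intros; apply i_coef_ge_0). lra.
Qed.

Lemma is_series_sph_bessel_entire (m : nat) (z : C) :
  is_series (fun n => RtoC (entire_coef m n) * z ^ n)%C (sph_bessel_entire m z).
Proof.
  apply (is_series_sparse m (fun k => z ^ m * sph_bessel_term m (z ^ 2) k)%C).
  - intros n Hn. unfold entire_coef. rewrite (proj1 (i_coef_closed n m) Hn), Rmult_0_r. ring.
  - intros k. unfold entire_coef, sph_bessel_term.
    rewrite (proj1 (proj2 (i_coef_closed (m + 2 * k) m)) k eq_refl).
    replace ((m + 2 * k - m) / 2)%nat with k.
    + rewrite <- Cpow_mult_r, Cpow_add_r. ring.
    + replace (m + 2 * k - m)%nat with (k * 2)%nat by lia. now rewrite Nat.div_mul.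
  - intros k. unfold entire_coef.
    rewrite (proj2 (proj2 (i_coef_closed (m + 2 * k + 1) m)) k eq_refl), Rmult_0_r. ring.
  - apply is_series_C_mult, is_series_sph_bessel_term.
Qed.

(** The induction uses rho + 1 <= 2 rho. The constant (2 rho)^n is coarser than n rho^(n-1), but
    summed against 1 / n! it gives exp (2 rho) directly. *)
Lemma Cpow_lipschitz (rho : R) (y z : C) (n : nat) :
  1 <= rho -> Cmod y <= rho -> Cmod z <= rho ->
  Cmod (y ^ n - z ^ n) <= (2 * rho) ^ n * Cmod (y - z).
Proof.
  intros H1 Hy Hz. induction n as [|n IH].
  - simpl. replace (1 - 1)%C with (RtoC 0) by ring. rewrite Cmod_0.
    pose proof (Cmod_ge_0 (y - z)). lra.
  - replace (y ^ S n - z ^ S n)%C with (y * (y ^ n - z ^ n) + (y - z) * z ^ n)%C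
      by (rewrite !Cpow_S; ring).
    eapply Rle_trans; [apply Cmod_triangle|]. rewrite !Cmod_mult, Cmod_pow.
    assert (A : Cmod z ^ n <= (2 * rho) ^ n).
    { apply pow_incr. split; [apply Cmod_ge_0 | lra]. }
    pose proof (Cmod_ge_0 (y - z)) as D. pose proof (Cmod_ge_0 y).
    assert (P : 0 <= (2 * rho) ^ n) by (apply pow_le; lra).
    apply Rle_trans with (rho * ((2 * rho) ^ n * Cmod (y - z)) + Cmod (y - z) * (2 * rho) ^ n).
    + apply Rplus_le_compat.
      * apply Rmult_le_compat; trivial. apply Cmod_ge_0.
      * now apply Rmult_le_compat_l.
    + simpl. assert (0 <= (2 * rho) ^ n * Cmod (y - z)) by now apply Rmult_le_pos. nra.
Qed.

Lemma sph_bessel_entire_lipschitz (m : nat) (rho : R) (y z : C) :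
  1 <= rho -> Cmod y <= rho -> Cmod z <= rho ->
  Cmod (sph_bessel_entire m y - sph_bessel_entire m z) <= Cmod (y - z) * exp (2 * rho).
Proof.
  intros H1 Hy Hz.
  apply (is_series_C_bound
    (fun n => RtoC (entire_coef m n) * y ^ n + (- (1)) * (RtoC (entire_coef m n) * z ^ n))%C)
    with (fun n => Cmod (y - z) * ((2 * rho) ^ n / INR (fact n))).
  - replace (sph_bessel_entire m y - sph_bessel_entire m z)%C
      with (sph_bessel_entire m y + (- (1)) * sph_bessel_entire m z)%C by ring.
    apply is_series_C_plus; [|apply is_series_C_mult]; apply is_series_sph_bessel_entire.
  - intros n.
    replace (RtoC (entire_coef m n) * y ^ n + (- (1)) * (RtoC (entire_coef m n) * z ^ n))%C
      with (RtoC (entire_coef m n) * (y ^ n - z ^ n))%C by ring.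
    rewrite Cmod_mult, Cmod_R.
    replace (Cmod (y - z) * ((2 * rho) ^ n / INR (fact n)))
      with (/ INR (fact n) * ((2 * rho) ^ n * Cmod (y - z)))
      by (unfold Rdiv; ring).
    apply Rmult_le_compat; [apply Rabs_pos | apply Cmod_ge_0 | apply entire_coef_abs_le|].
    now apply Cpow_lipschitz.
  - apply (is_series_scal_l (K := R_AbsRing) (V := R_NormedModule)), is_series_exp.
Qed.

Lemma continuous_sph_bessel_entire (m : nat) (z : C) :
  filterlim (sph_bessel_entire m) (locally (T := C_UniformSpace) z)
    (locally (T := C_R_CompleteNormedModule) (sph_bessel_entire m z)).
Proof.
  apply (proj2 (filterlim_locally (U := C_R_CompleteNormedModule) _ _)). intros eps.
  set (rho := Cmod z + 1). pose proof (Cmod_ge_0 z) as Z.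
  pose proof (exp_pos (2 * rho)) as E. pose proof (cond_pos eps) as Pe.
  assert (S2 : 0 < sqrt 2) by (apply sqrt_lt_R0; lra).
  (* A product ball of radius delta lies in the disc of radius sqrt 2 delta, hence the division. The
     minimum with 1 keeps y in the disc of radius rho, and the other bound beats the Lipschitz
     constant. *)
  assert (Pd : 0 < Rmin 1 (eps / exp (2 * rho)) / sqrt 2).
  { apply Rdiv_lt_0_compat; [|exact S2]. apply Rmin_glb_lt; [lra|].
    now apply Rdiv_lt_0_compat. }
  exists (mkposreal _ Pd). intros y Hy.
  apply C_NormedModule_mixin_compat2 in Hy.
  apply C_NormedModule_mixin_compat1.
  change (Cmod (y - z) < sqrt 2 * (Rmin 1 (eps / exp (2 * rho)) / sqrt 2)) in Hy.
  replace (sqrt 2 * (Rmin 1 (eps / exp (2 * rho)) / sqrt 2))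
    with (Rmin 1 (eps / exp (2 * rho))) in Hy by (field; lra).
  pose proof (Rmin_l 1 (eps / exp (2 * rho))). pose proof (Rmin_r 1 (eps / exp (2 * rho))).
  change (Cmod (sph_bessel_entire m y - sph_bessel_entire m z) < eps).
  eapply Rle_lt_trans; [apply (sph_bessel_entire_lipschitz m rho); unfold rho; [lra | | lra]|].
  - replace y with (z + (y - z))%C by ring.
    eapply Rle_trans; [apply Cmod_triangle|]. lra.
  - apply Rlt_le_trans with (eps / exp (2 * rho) * exp (2 * rho)).
    + apply Rmult_lt_compat_r; lra.
    + right. field. lra.
Qed.

Lemma slit_plane_dense (z : C) :
  ProperFilter (within slit_plane (locally (T := C_UniformSpace) z)).
Proof.
  split; [|apply within_filter, locally_filter].
  intros P [d Hd]. destruct (slit_plane_dec z) as [Hz|Hz].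
  - exists z. apply Hd; [apply ball_center | exact Hz].
  - assert (Iz : Im z = 0).
    { destruct (Req_dec (Im z) 0); trivial. exfalso. apply Hz. now left. }
    pose proof (cond_pos d).
    (* A point of the cut is approached vertically, off the real axis. *)
    exists (Re z, d / 2). apply Hd.
    + split; [apply ball_center|].
      change (Rabs (d / 2 - Im z) < d). rewrite Iz, Rabs_pos_eq; lra.
    + left. simpl. lra.
Qed.

(** On the cut, the continuous function [sph_bessel_entire m] agrees with the principal formula on
    the slit plane, so its value is a limit; density of the slit plane makes the limit unique and
    [iota] returns it. *)
Lemma sph_bessel_j_entire (m : nat) (z : C) : sph_bessel_j m z = sph_bessel_entire m z.
Proof.
  unfold sph_bessel_j. destruct (slit_plane_dec z) as [Hz|Hz].
  - now apply sph_bessel_principal_entire.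
  - assert (L : filterlim (sph_bessel_principal m)
              (within slit_plane (locally (T := C_UniformSpace) z))
              (locally (T := C_R_CompleteNormedModule) (sph_bessel_entire m z))).
    { apply (filterlim_within_ext slit_plane (sph_bessel_entire m)).
      - intros y Hy. symmetry. now apply sph_bessel_principal_entire.
      - eapply filterlim_filter_le_1; [apply filter_le_within|].
        apply continuous_sph_bessel_entire. }
    refine (iota_unique (V := C_R_CompleteNormedModule) _ (sph_bessel_entire m z) _ L).
    intros l Hl.
    pose proof (slit_plane_dense z) as PF.
    apply (filterlim_locally_unique (V := C_R_CompleteNormedModule) (sph_bessel_principal m) l
             (sph_bessel_entire m z) Hl L).
Qed.

(** * The two expansions *)

Lemma is_RInt_C_components (f : R -> C) (a b : R) (l : C) :
  is_RInt (fun t => Re (f t)) a b (Re l) -> is_RInt (fun t => Im (f t)) a b (Im l) ->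
  is_RInt (V := C_R_NormedModule) f a b l.
Proof.
  intros H1 H2. destruct l as [l1 l2].
  exact (is_RInt_fct_extend_pair (U := R_NormedModule) (V := R_NormedModule) f a b l1 l2 H1 H2).
Qed.

Lemma is_RInt_Re (f : R -> C) (a b : R) (l : C) :
  is_RInt (V := C_R_NormedModule) f a b l -> is_RInt (fun t => Re (f t)) a b (Re l).
Proof. exact (is_RInt_fct_extend_fst (U := R_NormedModule) (V := R_NormedModule) f a b l). Qed.

Lemma is_RInt_Im (f : R -> C) (a b : R) (l : C) :
  is_RInt (V := C_R_NormedModule) f a b l -> is_RInt (fun t => Im (f t)) a b (Im l).
Proof. exact (is_RInt_fct_extend_snd (U := R_NormedModule) (V := R_NormedModule) f a b l). Qed.

(** Integration treats [C] as a real vector space, so a complex factor is handled through real and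
    imaginary parts. *)
Lemma is_RInt_C_mult (c : C) (f : R -> C) (a b : R) (l : C) :
  is_RInt (V := C_R_NormedModule) f a b l ->
  is_RInt (V := C_R_NormedModule) (fun t => c * f t)%C a b (c * l)%C.
Proof.
  intros H. pose proof (is_RInt_Re _ _ _ _ H) as H1. pose proof (is_RInt_Im _ _ _ _ H) as H2.
  apply is_RInt_C_components.
  - exact (is_RInt_minus (V := R_NormedModule) _ _ _ _ _ _
             (is_RInt_scal (V := R_NormedModule) _ _ _ (Re c) _ H1)
             (is_RInt_scal (V := R_NormedModule) _ _ _ (Im c) _ H2)).
  - exact (is_RInt_plus (V := R_NormedModule) _ _ _ _ _ _
             (is_RInt_scal (V := R_NormedModule) _ _ _ (Re c) _ H2)
             (is_RInt_scal (V := R_NormedModule) _ _ _ (Im c) _ H1)).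
Qed.

Lemma is_RInt_RtoC (g : R -> R) (a b l : R) :
  is_RInt g a b l -> is_RInt (V := C_R_NormedModule) (fun t => RtoC (g t)) a b (RtoC l).
Proof.
  intros H. apply is_RInt_C_components; [exact H|].
  pose proof (is_RInt_const (V := R_NormedModule) a b 0) as H0.
  replace (Im (RtoC l)) with (scal (V := R_NormedModule) (b - a) 0); [exact H0|].
  unfold scal; simpl; unfold mult; simpl. ring.
Qed.

Section Expansion.

Variable theta : R.
Variable x : C.

Definition phase_int : C :=
  RInt (V := C_R_CompleteNormedModule) (fun s => Cexp (x * RtoC (phase theta s))) 0 1.

Lemma is_RInt_phase :
  is_RInt (V := C_R_NormedModule) (fun s => Cexp (x * RtoC (phase theta s))) 0 1 phase_int.
Proof.
  assert (A : ex_RInt (V := C_R_NormedModule) (fun s => Cexp (x * RtoC (phase theta s))) 0 1).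
  { assert (E1 : ex_RInt (fun s => Re (Cexp (x * RtoC (phase theta s)))) 0 1).
    { apply (ex_RInt_continuous (fun s => Re (Cexp (x * RtoC (phase theta s))))). intros s _.
      apply (ex_derive_continuous (fun s => Re (Cexp (x * RtoC (phase theta s))))).
      unfold phase, Cexp, Cmult, RtoC, Re, Im; cbn [fst snd]. auto_derive. exact I. }
    assert (E2 : ex_RInt (fun s => Im (Cexp (x * RtoC (phase theta s)))) 0 1).
    { apply (ex_RInt_continuous (fun s => Im (Cexp (x * RtoC (phase theta s))))). intros s _.
      apply (ex_derive_continuous (fun s => Im (Cexp (x * RtoC (phase theta s))))).
      unfold phase, Cexp, Cmult, RtoC, Re, Im; cbn [fst snd]. auto_derive. exact I. }
    destruct E1 as [l1 H1], E2 as [l2 H2]. exists (l1, l2).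
    now apply is_RInt_C_components. }
  exact (RInt_correct (V := C_R_CompleteNormedModule) _ _ _ A).
Qed.

Lemma is_RInt_phase_partial_sum (N : nat) :
  is_RInt (V := C_R_NormedModule)
    (fun s => sum_n (fun n => (x * RtoC (phase theta s)) ^ n / INR (fact n))%C N) 0 1
    (sum_n (fun n => RtoC (phase_moment theta n / INR (fact n)) * x ^ n)%C N).
Proof.
  assert (T : forall n, is_RInt (V := C_R_NormedModule)
    (fun s => (x * RtoC (phase theta s)) ^ n / INR (fact n))%C 0 1
    (RtoC (phase_moment theta n / INR (fact n)) * x ^ n)%C).
  { intros n. assert (F : RtoC (INR (fact n)) <> 0) by apply RtoC_neq, INR_fact_neq_0.
    assert (E : forall s, (x ^ n / INR (fact n) * RtoC (phase theta s ^ n))%C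
                          = ((x * RtoC (phase theta s)) ^ n / INR (fact n))%C).
    { intros s. rewrite Cpow_mult_l, RtoC_pow. field. exact F. }
    apply (is_RInt_ext (V := C_R_NormedModule)
             (fun s => x ^ n / INR (fact n) * RtoC (phase theta s ^ n))%C).
    - intros s _. apply E.
    - replace (RtoC (phase_moment theta n / INR (fact n)) * x ^ n)%C
        with (x ^ n / INR (fact n) * RtoC (phase_moment theta n))%C.
      + apply is_RInt_C_mult, is_RInt_RtoC, is_RInt_phase_pow.
      + rewrite RtoC_div by apply INR_fact_neq_0. field. exact F. }
  induction N as [|N IH].
  - rewrite sum_O. apply (is_RInt_ext (V := C_R_NormedModule)) with (2 := T O).
    intros s _. now rewrite sum_O.
  - rewrite sum_Sn.
    apply (is_RInt_ext (V := C_R_NormedModule)) with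
      (2 := is_RInt_plus (V := C_R_NormedModule) _ _ _ _ _ _ IH (T (S N))).
    intros s _. now rewrite sum_Sn.
Qed.

(** Termwise integration is justified by a Taylor remainder uniform in s: on [0, 1] the argument x
    q(s) has modulus at most that of x. *)
Lemma is_series_phase_int :
  is_series (fun n => RtoC (phase_moment theta n / INR (fact n)) * x ^ n)%C
    phase_int.
Proof.
  apply is_series_C_squeeze with
    (fun N => 2 * exp (Cmod x) * (Cmod x ^ S N / INR (fact (S N)))).
  2:{ replace 0 with (2 * exp (Cmod x) * 0) by ring.
      apply (is_lim_seq_scal_l _ (2 * exp (Cmod x)) 0), is_lim_seq_pow_fact. }
  intros N.
  pose proof (is_RInt_minus (V := C_R_NormedModule) _ _ _ _ _ _
                is_RInt_phase (is_RInt_phase_partial_sum N)) as H.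
  match goal with |- Cmod (?S - _) <= _ => set (T := S) in * end.
  replace (Cmod (T - phase_int)) with (Cmod (phase_int - T))
    by (rewrite <- Cmod_opp; f_equal; ring).
  rewrite Cmod_norm.
  (* The bound is displayed as the length of the interval times a bound on the integrand. *)
  rewrite <- (Rmult_1_l (_ * _)). replace 1 with (1 - 0) at 1 by ring.
  refine (norm_RInt_le_const (V := C_R_NormedModule) _ 0 1 _ _ Rle_0_1 _ H).
  intros s Hs.
  change (norm (V := C_R_NormedModule) (Cexp (x * RtoC (phase theta s))
    - sum_n (fun n => (x * RtoC (phase theta s)) ^ n / INR (fact n)) N)%C
    <= 2 * exp (Cmod x) * (Cmod x ^ S N / INR (fact (S N)))).
  rewrite <- Cmod_norm. eapply Rle_trans; [apply Cexp_Taylor|].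
  assert (B : Cmod (x * RtoC (phase theta s)) <= Cmod x).
  { rewrite Cmod_mult, Cmod_R. pose proof (phase_abs_le theta s Hs).
    pose proof (Cmod_ge_0 x). nra. }
  rewrite <- Rmult_assoc.
  assert (P : 0 <= Cmod (x * RtoC (phase theta s)) ^ S N / INR (fact (S N))).
  { apply Rmult_le_pos; [apply pow_le, Cmod_ge_0|].
    left. apply Rinv_0_lt_compat, INR_fact_lt_0. }
  apply Rmult_le_compat; trivial.
  - pose proof (exp_pos (Cmod (x * RtoC (phase theta s)))). lra.
  - apply Rmult_le_compat_l; [lra|].
    destruct B as [B|B]; [left; now apply exp_increasing | rewrite B; lra].
  - apply Rmult_le_compat_r; [left; apply Rinv_0_lt_compat, INR_fact_lt_0|].
    apply pow_incr. split; [apply Cmod_ge_0 | exact B].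
Qed.

Lemma is_series_dawson_coef :
  is_series (fun n => RtoC (dawson_coef theta n) * x ^ n)%C (RtoC (cos theta) * phase_int)%C.
Proof.
  apply (is_series_ext (fun n => RtoC (cos theta)
     * (RtoC (phase_moment theta n / INR (fact n)) * x ^ n))%C).
  - intros n. rewrite Cmult_assoc, <- RtoC_mult. f_equal. f_equal.
    unfold dawson_coef. field. apply INR_fact_neq_0.
  - apply is_series_C_mult, is_series_phase_int.
Qed.

(** The bound is inherited from the equal harmonic sum with M = n. *)
Lemma dawson_coef_abs_le (n : nat) : Rabs (dawson_coef theta n) <= / INR (fact n).
Proof.
  rewrite <- (sum_harmonic_eq theta n n (le_n n)). apply sum_harmonic_abs_le.
Qed.

Definition harmonic_term (m : nat) : C :=
  ((- Ci) ^ m * sph_bessel_j m (- Ci * x) * RtoC (cos ((2 * INR m + 1) * theta)))%C.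

(** The explicit (-i)^m and the one from (-i x)^m multiply to the sign (-1)^m of [harmonic], while
    (-i)^(2k) = (-1)^k cancels the alternating sign of j_m. *)
Lemma is_series_harmonic_term (m : nat) :
  is_series (fun n => RtoC (harmonic theta m * i_coef n m) * x ^ n)%C (harmonic_term m).
Proof.
  unfold harmonic_term. rewrite sph_bessel_j_entire.
  set (c := RtoC (cos ((2 * INR m + 1) * theta))).
  assert (Ci2 : forall k, ((- Ci) ^ (2 * k))%C = RtoC ((-1) ^ k)).
  { intros k. rewrite Cpow_mult_r, RtoC_pow. f_equal.
    unfold Ci, Copp, RtoC. simpl. unfold Cmult. simpl. f_equal; ring. }
  assert (Ci_m : ((- Ci) ^ m * (- Ci) ^ m)%C = RtoC ((-1) ^ m)).
  { rewrite <- Ci2, <- Cpow_add_r. f_equal. lia. }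
  replace ((- Ci) ^ m * sph_bessel_entire m (- Ci * x) * c)%C
    with ((c * RtoC ((-1) ^ m) * x ^ m) * CSeries (sph_bessel_term m ((- Ci * x) ^ 2)))%C.
  2:{ unfold sph_bessel_entire. rewrite (Cpow_mult_l (- Ci) x m), <- Ci_m. ring. }
  apply (is_series_sparse m (fun k => (c * RtoC ((-1) ^ m) * x ^ m)
                                      * sph_bessel_term m ((- Ci * x) ^ 2) k)%C).
  - intros n Hn. rewrite (proj1 (i_coef_closed n m) Hn), Rmult_0_r. ring.
  - intros k. rewrite (proj1 (proj2 (i_coef_closed (m + 2 * k) m)) k eq_refl).
    unfold sph_bessel_term, harmonic, c.
    rewrite <- Cpow_mult_r, Cpow_mult_l, Ci2, Cpow_add_r.
    replace (RtoC ((-1) ^ m * cos ((2 * INR m + 1) * theta) * bessel_coef m k))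
      with (RtoC (cos ((2 * INR m + 1) * theta)) * RtoC ((-1) ^ m)
            * (RtoC ((-1) ^ k * bessel_coef m k) * RtoC ((-1) ^ k)))%C; [ring|].
    rewrite <- !RtoC_mult. f_equal.
    replace ((-1) ^ k * bessel_coef m k * (-1) ^ k)
      with (((-1) ^ k * (-1) ^ k) * bessel_coef m k) by ring.
    rewrite <- Rpow_mult_distr. replace (-1 * -1) with 1 by ring. rewrite pow1. ring.
  - intros k. rewrite (proj2 (proj2 (i_coef_closed (m + 2 * k + 1) m)) k eq_refl), Rmult_0_r. ring.
  - apply is_series_C_mult, is_series_sph_bessel_term.
Qed.

Lemma is_series_harmonic_partial_sum (M : nat) :
  is_series (fun n => RtoC (sum_f_R0 (fun m => harmonic theta m * i_coef n m)%R M) * x ^ n)%C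
    (sum_n harmonic_term M).
Proof.
  induction M as [|M IH].
  - rewrite sum_O. apply is_series_harmonic_term.
  - rewrite sum_Sn.
    apply (is_series_ext (fun n =>
      RtoC (sum_f_R0 (fun m => harmonic theta m * i_coef n m)%R M) * x ^ n
      + RtoC (harmonic theta (S M) * i_coef n (S M)) * x ^ n)%C).
    + intros n. rewrite tech5, RtoC_plus.
      symmetry. apply Cmult_plus_distr_r.
    + apply is_series_C_plus; [exact IH | apply is_series_harmonic_term].
Qed.

(** Comparing with an exponential series at 2 |x| instead of |x| spares a tail estimate: the extra
    2^n pays for the factor 2^(-M). *)
Lemma harmonic_partial_sum_error (M : nat) :
  Cmod (sum_n harmonic_term M - RtoC (cos theta) * phase_int)
  <= 2 * exp (2 * Cmod x) * (/ 2) ^ M.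
Proof.
  apply (is_series_C_bound (fun n =>
      RtoC (sum_f_R0 (fun m => harmonic theta m * i_coef n m)%R M) * x ^ n
      + (- (1)) * (RtoC (dawson_coef theta n) * x ^ n))%C)
    with (fun n => 2 * (/ 2) ^ M * ((2 * Cmod x) ^ n / INR (fact n))).
  - replace (sum_n harmonic_term M - RtoC (cos theta) * phase_int)%C
      with (sum_n harmonic_term M + (- (1)) * (RtoC (cos theta) * phase_int))%C by ring.
    apply is_series_C_plus; [apply is_series_harmonic_partial_sum|].
    apply is_series_C_mult, is_series_dawson_coef.
  - (* The [n]-th coefficients agree for [n <= M], and [1 <= 2^n / 2^M] otherwise. *)
    intros n. set (h := sum_f_R0 _ M). set (d := dawson_coef theta n).
    replace (RtoC h * x ^ n + (- (1)) * (RtoC d * x ^ n))%C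
      with (RtoC (h - d) * x ^ n)%C by (rewrite RtoC_minus; ring).
    rewrite Cmod_mult, Cmod_R, Cmod_pow, Rpow_mult_distr.
    pose proof (pow_le _ n (Cmod_ge_0 x)) as Px.
    assert (F : 0 < / INR (fact n)) by apply Rinv_0_lt_compat, INR_fact_lt_0.
    assert (P2 : forall k, 0 < 2 ^ k) by (intros; apply pow_lt; lra).
    destruct (Nat.le_gt_cases n M) as [L|L].
    + unfold h, d. rewrite sum_harmonic_eq by exact L.
      rewrite Rminus_diag, Rabs_R0, Rmult_0_l. unfold Rdiv.
      pose proof (pow_lt (/ 2) M ltac:(lra)). pose proof (P2 n).
      repeat apply Rmult_le_pos; lra.
    + assert (H : Rabs (h - d) <= 2 * / INR (fact n)).
      { unfold Rminus. eapply Rle_trans; [apply Rabs_triang|]. rewrite Rabs_Ropp.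
        pose proof (sum_harmonic_abs_le theta n M). pose proof (dawson_coef_abs_le n).
        unfold h, d. lra. }
      assert (G : 1 <= (/ 2) ^ M * 2 ^ n).
      { rewrite pow_inv. apply (Rmult_le_reg_l (2 ^ M)); [apply P2|].
        replace (2 ^ M * (/ 2 ^ M * 2 ^ n)) with (2 ^ n) by (field; apply Rgt_not_eq, P2).
        rewrite Rmult_1_r. apply Rle_pow; [lra | lia]. }
      apply Rle_trans with (2 * / INR (fact n) * Cmod x ^ n).
      { now apply Rmult_le_compat_r. }
      replace (2 * (/ 2) ^ M * (2 ^ n * Cmod x ^ n / INR (fact n)))
        with (2 * / INR (fact n) * Cmod x ^ n * ((/ 2) ^ M * 2 ^ n)) by (unfold Rdiv; ring).
      rewrite <- (Rmult_1_r (2 * / INR (fact n) * Cmod x ^ n)) at 1.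
      apply Rmult_le_compat_l; [|exact G]. apply Rmult_le_pos; [lra | exact Px].
  - replace (2 * exp (2 * Cmod x) * (/ 2) ^ M) with (2 * (/ 2) ^ M * exp (2 * Cmod x)) by ring.
    apply (is_series_scal_l (K := R_AbsRing) (V := R_NormedModule)), is_series_exp.
Qed.

Lemma is_series_harmonic :
  is_series harmonic_term (RtoC (cos theta) * phase_int)%C.
Proof.
  apply is_series_C_squeeze with (fun M => 2 * exp (2 * Cmod x) * (/ 2) ^ M).
  - exact harmonic_partial_sum_error.
  - replace 0 with (2 * exp (2 * Cmod x) * 0) by ring.
    apply (is_lim_seq_scal_l _ (2 * exp (2 * Cmod x)) 0), is_lim_seq_geom.
    rewrite Rabs_pos_eq; lra.
Qed.

End Expansion.

(** * Dawson's integral through the phase integral, and the conclusion *)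

Lemma Dawson_phase_int (w : C) (theta : R) :
  Dawson (w * RtoC (cos theta))%C
  = (w * Cexp (- (w ^ 2) / 2) * (RtoC (cos theta) * phase_int theta (w ^ 2 / 2)))%C.
Proof.
  set (x := (w ^ 2 / 2)%C). set (c := cos theta). set (z := (w * RtoC c)%C).
  assert (H2 : RtoC 2 <> 0) by (apply RtoC_neq; lra).
  assert (Hcos : RtoC (cos (2 * theta)) = (2 * (RtoC c * RtoC c) - 1)%C).
  { rewrite cos_2a_cos, RtoC_minus, !RtoC_mult. unfold c. ring. }
  assert (Hz : (z ^ 2)%C = (2 * x * (RtoC c * RtoC c))%C) by (unfold z, x; field).
  assert (I : CInt_segment (fun t => Cexp (t ^ 2)) 0 z
              = (z * Cexp (x * RtoC (cos (2 * theta))) * phase_int theta x)%C).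
  { apply (is_RInt_unique (V := C_R_CompleteNormedModule)).
    (* As z^2 = 2 x cos^2 theta = x (1 + cos (2 theta)), the exponent t^2 z^2 is x cos (2 theta)
       plus x times the phase at t. *)
    assert (E : forall t, (z * Cexp (x * RtoC (cos (2 * theta)))
                           * Cexp (x * RtoC (phase theta t)))%C
                          = (Cexp ((0 + RtoC t * (z - 0)) ^ 2) * (z - 0))%C).
    { intros t. rewrite <- Cmult_assoc, <- Cexp_add.
      replace ((0 + RtoC t * (z - 0)) ^ 2)%C with (RtoC t * RtoC t * z ^ 2)%C by ring.
      replace (x * RtoC (cos (2 * theta)) + x * RtoC (phase theta t))%C
        with (RtoC t * RtoC t * z ^ 2)%C; [ring|].
      rewrite Hz. unfold phase.
      rewrite RtoC_minus, RtoC_mult, RtoC_plus, RtoC_pow, Hcos. ring. }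
    apply (is_RInt_ext (V := C_R_NormedModule)
      (fun t => z * Cexp (x * RtoC (cos (2 * theta))) * Cexp (x * RtoC (phase theta t)))%C).
    - intros t _. apply E.
    - apply is_RInt_C_mult, is_RInt_phase. }
  unfold Dawson. rewrite I.
  transitivity (w * (Cexp (- (z ^ 2)) * Cexp (x * RtoC (cos (2 * theta))))
                * (RtoC c * phase_int theta x))%C; [unfold z; ring|].
  (* The prefactors combine because -z^2 + x cos (2 theta) = -x. *)
  rewrite <- Cexp_add. f_equal. f_equal. f_equal.
  rewrite Hz, Hcos. unfold x. field.
Qed.

Theorem mainTheorem9 (w : C) (theta : R) :
  let a : nat -> C := fun m : nat =>
    ((- Ci) ^ m * sph_bessel_j m (- Ci * w ^ 2 / 2)
     * RtoC (cos ((2 * INR m + 1) * theta)))%C in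
  ex_series a /\
  Dawson (w * RtoC (cos theta))%C = (w * Cexp (- (w ^ 2) / 2) * CSeries a)%C.
Proof.
  intros a.
  assert (H : is_series a (RtoC (cos theta) * phase_int theta (w ^ 2 / 2))%C).
  { apply is_series_ext with (2 := is_series_harmonic theta (w ^ 2 / 2)%C).
    intros m. unfold a, harmonic_term.
    replace (- Ci * w ^ 2 / 2)%C with (- Ci * (w ^ 2 / 2))%C by (unfold Cdiv; ring).
    reflexivity. }
  split; [now exists (RtoC (cos theta) * phase_int theta (w ^ 2 / 2))%C|].
  rewrite (CSeries_unique _ _ H). apply Dawson_phase_int.
Qed.
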